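(* Let $n,d,r$ be positive integers and let $\hat g(n;d)$ be the number of $r$-regular bipartite multi-graphs on color classes $U,V$, $|U|=|V|=n$, in which no set of pairwise non-crossing edges, which may share endpoints, has more than $d$ edges. Then $\hat g(n;d)$ equals the number of (ordered) pairs of equal shape Young tableaux in $T([rn];d)$, both satisfying the following condition: for each $i\in\{1,\dots,n\}$ and $1\le s<r$, the row containing $r(i-1)+s+1$ is weakly above the row containing $r(i-1)+s$. Moreover, $$\hat g(n;d)=\sum_{\pi}\operatorname{sign}(\pi)\,\bigl|\widehat W'(d,2rn;T(\pi))\bigr|,$$ where the sum is over all permutations $\pi$ of $\{1,\dots,d\}$.
   Context: Graphs. $U=\{u_1\prec\dots\prec u_n\}$ and $V=\{v_1\prec\dots\prec v_n\}$ are disjoint totally ordered sets. An $r$-regular bipartite multi-graph on $U,V$ is given by nonnegative integer edge multiplicities such that every vertex has degree $r$ counted with multiplicity. Here edges may share endpoints: two distinct edges $uv$, $u'v'$ (possibly parallel) are non-crossing if $u\preceq u'$ and $v\preceq v'$, or $u'\preceq u$ and $v'\preceq v$. The size of a set of edges counts parallel edges separately. Tableaux. A (standard) Young tableau has distinct integer entries in left-justified rows of weakly decreasing lengths (row $i$ above row $i+1$), increasing along rows from left to right and along columns from top to bottom. $[k]=\{1,\dots,k\}$. $T(S;d)$ is the set of Young tableaux whose set of entries is $S$ (each element used exactly once) and which have at most $d$ columns. Walks. A lattice walk in $\mathbb{Z}^d$ has steps $+\vec e_j$ (positive, direction $j$) or $-\vec e_j$ (negative, direction $j$), $1\le j\le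 d$. $W^*(d,M;\vec p)$ is the set of walks of length $M$ from the origin to $\vec p$ in which all positive steps precede all negative steps, written $a_1a_2\cdots|b_1b_2\cdots$ with $a_i,b_j\in\{1,\dots,d\}$ the directions of the successive positive and negative steps. For a permutation $\pi$ of $\{1,\dots,d\}$, $T(\pi)=(1-\pi(1),\dots,d-\pi(d))$; a walk of length $2m$ from the origin to $T(\pi)$ has $m$ positive and $m$ negative steps. With $m=rn$, $\widehat W'(d,2m;T(\pi))$ is the set of walks $a_1\cdots a_m|b_1\cdots b_m$ in $W^*(d,2m;T(\pi))$ such that $a_{r(i-1)+s}<a_{r(i-1)+s+1}$ and $b_{r(i-1)+s}<b_{r(i-1)+s+1}$ for all $1\le i\le n$, $1\le s<r$. *)

(* Defs.v *)
From HB Require Import structures.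
From mathcomp Require Import all_boot all_order all_algebra all_fingroup.

Set Implicit Arguments.
Unset Strict Implicit.
Unset Printing Implicit Defensive.

Import Order.TTheory GRing.Theory Num.Theory.

(* Both colour classes are 'I_n with its natural order.  G (u, v) is the
   multiplicity of uv; in an r-regular multigraph no multiplicity exceeds r,
   so the bound built into the type excludes nothing. *)
Definition multigraph (n r : nat) := {ffun 'I_n * 'I_n -> 'I_r.+1}.

Definition regular (n r : nat) (G : multigraph n r) : bool :=
  [forall u : 'I_n, \sum_(v : 'I_n) G (u, v) == r] &&
  [forall v : 'I_n, \sum_(u : 'I_n) G (u, v) == r].

(* (u, v, k) stands for the k-th parallel copy of the edge uv. *)
Definition edge (n r : nat) := ('I_n * 'I_n * 'I_r)%type.

Definition edges (n r : nat) (G : multigraph n r) : {set edge n r} :=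
  [set e : edge n r | e.2 < G e.1].

Definition noncrossing (n r : nat) (e f : edge n r) : bool :=
  ((e.1.1 <= f.1.1) && (e.1.2 <= f.1.2)) ||
  ((f.1.1 <= e.1.1) && (f.1.2 <= e.1.2)).

Definition pairwise_noncrossing (n r : nat) (E : {set edge n r}) : bool :=
  [forall e in E, forall f in E, (e != f) ==> noncrossing e f].

Definition ghat (n d r : nat) : nat :=
  #|[set G : multigraph n r | regular G &&
       [forall E : {set edge n r},
          (E \subset edges G) && pairwise_noncrossing E ==> (#|E| <= d)]]|.

Definition column_lt (row1 row2 : seq nat) : bool :=
  all (fun j => nth 0 row1 j < nth 0 row2 j) (iota 0 (size row2)).

(* A tableau is the list of its rows from top to bottom.  Rows are required to
   be nonempty so that each tableau has exactly one representation. *)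
Definition young_tableau (t : seq (seq nat)) : bool :=
  [&& all (fun row => row != [::]) t,
      sorted geq (shape t),
      all (sorted ltn) t,
      sorted column_lt t
    & uniq (flatten t)].

(* t belongs to T([k]; d). *)
Definition in_T (k d : nat) (t : seq (seq nat)) : bool :=
  [&& young_tableau t,
      perm_eq (flatten t) (iota 1 k)
    & all (fun row => size row <= d) t].

(* A finite type containing every tableau with set of entries [k]: at most k
   rows, each of length at most k, with entries at most k. *)
Definition filling (k : nat) := k.-bseq (k.-bseq 'I_k.+1).

Definition rows_of (k : nat) (t : filling k) : seq (seq nat) :=
  [seq [seq val x | x <- val row] | row <- val t].

Definition row_of (x : nat) (t : seq (seq nat)) : nat :=
  find (fun row : seq nat => x \in row) t.

(* i is 0-based here: the i-th block is r * i + 1, ..., r * i + r. *)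
Definition row_condition (n r : nat) (t : seq (seq nat)) : bool :=
  [forall i : 'I_n, forall s : 'I_r,
     (1 <= s) ==> (row_of (r * i + s + 1) t <= row_of (r * i + s) t)].

Definition tableau_pairs (n d r : nat) :
    {set filling (r * n) * filling (r * n)} :=
  [set p | [&& in_T (r * n) d (rows_of p.1),
               in_T (r * n) d (rows_of p.2),
               shape (rows_of p.1) == shape (rows_of p.2),
               row_condition n r (rows_of p.1)
             & row_condition n r (rows_of p.2)]].

(* (true, j) is the positive step in direction j, (false, j) the negative
   one; directions are 0-based. *)
Definition step (d : nat) := (bool * 'I_d)%type.

Definition step_vec (d : nat) (x : step d) : 'rV[int]_d :=
  if x.1 then delta_mx 0%R x.2 else (- delta_mx 0%R x.2)%R.

Definition endpoint (d : nat) (w : seq (step d)) : 'rV[int]_d :=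
  (\sum_(x <- w) step_vec x)%R.

Definition Wstar (d M : nat) (p : 'rV[int]_d) : {set M.-tuple (step d)} :=
  [set w : M.-tuple (step d) | (endpoint w == p) &&
     [forall i : 'I_M, forall j : 'I_M,
        (tnth w i).1 && ~~ (tnth w j).1 ==> (i < j)]].

Definition pos_dirs (d : nat) (w : seq (step d)) : seq nat :=
  [seq val x.2 | x <- w & x.1].

Definition neg_dirs (d : nat) (w : seq (step d)) : seq nat :=
  [seq val x.2 | x <- w & ~~ x.1].

(* a is 0-based: its (r(i-1)+s)-th term is at index r(i-1)+s-1, and i - 1 is
   written i. *)
Definition block_increasing (n r : nat) (a : seq nat) : bool :=
  [forall i : 'I_n, forall s : 'I_r,
     (1 <= s) ==> (nth 0 a (r * i + s).-1 < nth 0 a (r * i + s))].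

Definition What' (n r d : nat) (p : 'rV[int]_d) :
    {set (2 * (r * n)).-tuple (step d)} :=
  [set w in Wstar (2 * (r * n)) p |
     [&& size (pos_dirs w) == r * n,
         size (neg_dirs w) == r * n,
         block_increasing n r (pos_dirs w)
       & block_increasing n r (neg_dirs w)]].

(* Equal to j - pi(j) in either 0-based or 1-based indexing. *)
Definition T_point (d : nat) (pi : 'S_d) : 'rV[int]_d :=
  (\row_(j < d) (j%:Z - (pi j)%:Z))%R.

(* Main.v *)
Require Import Defs.
From mathcomp Require Import all_boot all_order all_algebra all_fingroup.
From mathcomp Require Import zify.

Set Implicit Arguments.
Unset Strict Implicit.
Unset Printing Implicit Defensive.

Import Order.TTheory GRing.Theory Num.Theory.

(** All three counts equal the number of pairs (A, B) of ballot sequences of n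
    sets of columns, each of size r, with the same content ([ballot_pairs]).
    Such a sequence describes a Young diagram with at most d columns growing in
    n steps: the i-th set lists the columns that receive a box in the i-th step,
    so a step adds a horizontal strip of r boxes, the content gives the column
    heights, and the ballot property says that the heights stay weakly
    decreasing.  The row lengths of these diagrams form an interlacing chain,
    and [chain_columns] together with [row_len_inj] says that passing to the
    conjugate loses nothing.

    Multigraphs correspond to these pairs by the Robinson-Schensted-Knuth
    correspondence, in the form of Fomin's growth diagrams: partitions are
    attached to the points of the grid, and those around a cell are related by
    a piecewise linear local rule.  For fixed neighbours the rule is a bijection
    between (lower corner, edge multiplicity) and upper corner, so the whole
    multiplicity matrix is equivalent to the two chains of partitions along the
    far sides of the square ([growth_inj], [growth_of_chains]).  The row and
    column sums of the matrix are the step sizes of the chains.  The first parts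
    satisfy the last passage recursion, maximum of the two predecessors plus the
    multiplicity of the cell, which is also the recursion for the largest
    noncrossing set of edges ([noncrossing_bound]).  Hence the bound d on
    noncrossing sets is the bound d on the number of columns.

    For a tableau, the boxes with entries at most r * i form the i-th diagram of
    the chain.  The row condition forces the entries of a block to move strictly
    to the right, so that they occupy a horizontal strip, and the strip in turn
    determines where each entry of the block goes ([tableau_columns],
    [tableau_unique], [tableau_of_in_T]).

    For the walks, a word whose blocks increase is a sequence of sets of
    directions, so the signed sum is the sum of [alt_delta] over the endpoints
    of all pairs of sequences (A, B), in coordinates shifted by the staircase
    [delta].  This function is alternating, hence zero as soon as two
    coordinates agree.  A step by a set changes a difference of coordinates by
    at most one, so a path cannot leave the region of strictly increasing
    coordinates without first reaching such a wall, and there the sum over all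
    continuations vanishes ([sum_in_chamber]).  What remains are the paths that
    never leave the region and return to [delta]: A read forwards and B read
    backwards are ballot sequences with the same content. *)

(** * Counting by a bijective relation *)

(** Counting through a relation asks for no choice of a map: the elements of
    [SA] are matched one at a time with elements of [SB]. *)
Lemma leq_card_rel (A B : finType) (R : A -> B -> Prop) (SA : {set A}) (SB : {set B}) :
    {in SA, forall a, exists2 b, b \in SB & R a b} ->
    (forall a a' b, a \in SA -> a' \in SA -> R a b -> R a' b -> a = a') ->
  #|SA| <= #|SB|.
Proof.
move: {2}#|SA| (erefl #|SA|) => m; elim: m SA SB => [|m IH] SA SB cSA totR injR.
  by rewrite cSA.
have [a aSA] : exists a, a \in SA by apply/card_gt0P; rewrite cSA.
have [b bSB Rab] := totR a aSA.
rewrite (cardsD1 a) aSA (cardsD1 b) bSB leq_add2l; apply: IH.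
- by move: cSA; rewrite (cardsD1 a) aSA => -[].
- move=> a' /setD1P[a'a a'SA]; have [b' b'SB Ra'b'] := totR a' a'SA.
  exists b' => //; rewrite !inE b'SB andbT; apply: contra_neq a'a => b'b.
  by apply: (injR _ _ b) => //; rewrite -b'b.
- by move=> x y z /setD1P[_ xS] /setD1P[_ yS]; apply: injR.
Qed.

Lemma card_rel (A B : finType) (R : A -> B -> Prop) (SA : {set A}) (SB : {set B}) :
    {in SA, forall a, exists2 b, b \in SB & R a b} ->
    {in SB, forall b, exists2 a, a \in SA & R a b} ->
    (forall a a' b, a \in SA -> a' \in SA -> R a b -> R a' b -> a = a') ->
    (forall a b b', b \in SB -> b' \in SB -> R a b -> R a b' -> b = b') ->
  #|SA| = #|SB|.
Proof.
move=> tot1 tot2 inj1 inj2; apply/eqP; rewrite eqn_leq.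
rewrite (leq_card_rel tot1) //; apply: (@leq_card_rel _ _ (fun b a => R a b)) => //.
by move=> b b' a bS b'S Rb Rb'; apply: (inj2 a).
Qed.

(** * Growth diagrams *)

(** An array indexed by pairs of naturals, with given first row [P] and first
    column [Q], whose other values follow from the three neighbours of smaller
    index.  It serves to build growth diagrams from the corner 0 as well as
    backwards from the two far sides. *)
Section Fill.

Variables (X : Type) (g : nat -> nat -> X -> X -> X -> X) (P Q : nat -> X).

Fixpoint fill i : nat -> X :=
  if i isn't i'.+1 then P else
  fix fill_row j :=
    if j isn't j'.+1 then Q i
    else g i' j' (fill i' j') (fill i' j) (fill_row j').

Lemma fill0 : P 0 = Q 0 -> forall i, fill i 0 = Q i.
Proof. by move=> PQ [|i]. Qed.

Lemma fillS i j :
  fill i.+1 j.+1 = g i j (fill i j) (fill i j.+1) (fill i.+1 j).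
Proof. by []. Qed.

Lemma fill_rel n (le : X -> X -> Prop) :
    P 0 = Q 0 ->
    (forall j, j < n -> le (P j) (P j.+1)) ->
    (forall i, i < n -> le (Q i) (Q i.+1)) ->
    (forall i j x y z, le x y -> le x z -> le y (g i j x y z) /\ le z (g i j x y z)) ->
  forall i j, i <= n -> j <= n ->
    (j < n -> le (fill i j) (fill i j.+1)) /\ (i < n -> le (fill i j) (fill i.+1 j)).
Proof.
move=> PQ leP leQ leg; elim=> [|i IHi].
  move=> j _; elim: j => [|j IHj] jn.
    by split=> [n0|n0]; [apply: leP | rewrite /= PQ; apply: leQ].
  split=> [|n0]; first exact: leP.
  by rewrite fillS; apply: (leg _ _ _ _ _ _ _).1; [apply: leP|apply: (IHj (ltnW jn)).2].
move=> j lin; elim: j => [|j IHj] jn.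
  split=> [n0|n1]; last by rewrite !fill0 //; apply: leQ.
  rewrite fillS; apply: (leg _ _ _ _ _ _ _).2;
    first by apply: (IHi 0 _ _).1 => //; exact: ltnW.
  by apply: (IHi 0 _ _).2 => //; exact: ltnW.
have in' := ltnW lin; have jn' := ltnW jn.
have ej : le (fill i.+1 j) (fill i.+1 j.+1) by apply: (IHj _).1.
split=> [jn1|lin1].
  rewrite [fill i.+1 j.+2]fillS; apply: (leg _ _ _ _ _ _ _).2.
    exact: (IHi _ _ _).1.
  exact: (IHi _ _ _).2.
rewrite [fill i.+2 j.+1]fillS; apply: (leg _ _ _ _ _ _ _).1 => //.
exact: (IHj _).2.
Qed.

End Fill.

(** The skew shape m / l is a horizontal strip. *)
Definition interlace (l m : nat -> nat) := forall k, l k <= m k /\ m k.+1 <= l k.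

(** Fomin's local rule for the RSK correspondence in its piecewise linear form:
    [l] is the lower corner of a cell, [m] and [v] its neighbours, and [a] the
    matrix entry of the cell. *)
Definition local_rule (l m v : nat -> nat) a k :=
  if k isn't k'.+1 then maxn (m 0) (v 0) + a
  else maxn (m k) (v k) + (minn (m k') (v k') - l k').

Definition local_inverse (p m v : nat -> nat) k :=
  minn (m k) (v k) - (p k.+1 - maxn (m k.+1) (v k.+1)).

(** Given [m] and [v], interlacing confines the k-th part of a lower corner to
    the interval from max (m (k+1)) (v (k+1)) to min (m k) (v k), and the (k+1)-st
    part of an upper corner to the same interval.  The local rule reflects this
    interval, and its inverse reflects it back; the first part of the upper
    corner, which is bounded only from below, stores [a]. *)
Lemma local_rule_interlace l m v a : interlace l m -> interlace l v ->
  interlace m (local_rule l m v a) /\ interlace v (local_rule l m v a).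
Proof.
move=> lm lv; split=> -[|k] /=; have := lm 0; have := lv 0; have := lm; have := lv.
1,3: by lia.
all: by move=> /(_ k) + /(_ k); have := lm k.+1; have := lv k.+1; lia.
Qed.

Lemma local_inverse_interlace p m v : interlace m p -> interlace v p ->
  interlace (local_inverse p m v) m /\ interlace (local_inverse p m v) v.
Proof.
by move=> mp vp; split=> k; rewrite /local_inverse;
  move: (mp k) (vp k) (mp k.+1) (vp k.+1); lia.
Qed.

Lemma local_ruleK l m v a : interlace l m -> interlace l v ->
  local_inverse (local_rule l m v a) m v =1 l.
Proof. by move=> lm lv k; rewrite /local_inverse /=; move: (lm k) (lv k); lia. Qed.

Lemma local_inverseK p m v : interlace m p -> interlace v p ->
  local_rule (local_inverse p m v) m v (p 0 - maxn (m 0) (v 0)) =1 p.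
Proof.
move=> mp vp [|k]; rewrite /local_inverse /=; first by move: (mp 0) (vp 0); lia.
by move: (mp k) (vp k) (mp k.+1) (vp k.+1); lia.
Qed.

(** Box counts behave like a rectangle rule, since max + min is the sum. *)
Lemma sum_local_rule K l m v a : interlace l m -> interlace l v -> minn (m K) (v K) = 0 ->
  \sum_(k < K.+1) local_rule l m v a k + \sum_(k < K.+1) l k =
  \sum_(k < K.+1) m k + \sum_(k < K.+1) v k + a.
Proof.
move=> lm lv mvK.
have -> : \sum_(k < K.+1) l k = \sum_(k < K) l k.
  by rewrite big_ord_recr /= [l K](_ : _ = 0) ?addn0 //; have := lm K; have := lv K; lia.
rewrite big_ord_recl /= -addnA -big_split /=.
under eq_bigr => k _ do rewrite /bump add1n /=.
rewrite (eq_bigr (fun k : 'I_K => maxn (m k.+1) (v k.+1) + minn (m k) (v k))); last first.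
  by move=> k _; rewrite add0n; have := lm k; have := lv k; lia.
rewrite big_split /=.
have -> : \sum_(k < K) minn (m k) (v k) = \sum_(k < K.+1) minn (m k) (v k).
  by rewrite big_ord_recr /= mvK addn0.
have -> : \sum_(k < K.+1) m k + \sum_(k < K.+1) v k =
    \sum_(k < K.+1) maxn (m k) (v k) + \sum_(k < K.+1) minn (m k) (v k).
  by rewrite -!big_split; apply: eq_bigr => k _ /=; lia.
have -> : \sum_(k < K.+1) maxn (m k) (v k) =
    maxn (m 0) (v 0) + \sum_(k < K) maxn (m k.+1) (v k.+1) by rewrite big_ord_recl.
by rewrite addnAC !addnA.
Qed.

(** The partitions of a growth diagram of the matrix [M] on the grid of side [n]:
    [L i j k] is the k-th part at the point (i, j). *)
Record growth n (M : nat -> nat -> nat) (L : nat -> nat -> nat -> nat) : Prop := Growth {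
  growth_right : forall i j, i <= n -> j < n -> interlace (L i j) (L i j.+1);
  growth_down : forall i j, i < n -> j <= n -> interlace (L i j) (L i.+1 j);
  growth_cell : forall i j, i < n -> j < n ->
    L i.+1 j.+1 =1 local_rule (L i j) (L i j.+1) (L i.+1 j) (M i j);
  growth0l : forall j k, j <= n -> L 0 j k = 0;
  growth0r : forall i k, i <= n -> L i 0 k = 0 }.

Lemma growth_exists n M : exists L, growth n M L.
Proof.
pose z := fun (_ k : nat) => 0.
pose L := fill (fun i j l m v => local_rule l m v (M i j)) z z; exists L.
have ii : interlace (z 0) (z 0) by [].
have := @fill_rel _ (fun i j l m v => local_rule l m v (M i j)) z z n interlace erefl
   (fun _ _ => ii) (fun _ _ => ii)
  (fun i j x y v => @local_rule_interlace x y v (M i j)).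
rewrite -/L => H; split=> //.
- by move=> i j lin jn; apply: (H _ _ _ (ltnW jn)).1.
- by move=> i j lin jn; apply: (H _ _ (ltnW lin) _).2.
- by move=> [|i] k.
Qed.

Definition interlacing_chain n (P : nat -> nat -> nat) :=
  (forall k, P 0 k = 0) /\ forall i, i < n -> interlace (P i) (P i.+1).

(** A horizontal strip adds at most one row, so i steps produce at most i rows. *)
Lemma chain_support n P : interlacing_chain n P ->
  forall i k, i <= n -> i <= k -> P i k = 0.
Proof.
move=> [P0 PS]; elim=> [|i IHi] [|k] // lin ik.
apply/eqP; rewrite -leqn0 -(IHi k (ltnW lin) ik).
by case: (PS i lin k).
Qed.

Lemma chain_mono n P : interlacing_chain n P ->
  forall i i' k, i <= i' -> i' <= n -> P i k <= P i' k.
Proof.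
move=> [P0 PS] i + k; elim=> [|i' IH]; first by rewrite leqn0 => /eqP->.
rewrite leq_eqVlt => /predU1P[->//|ii'] i'n.
by apply: leq_trans (IH ii' (ltnW i'n)) _; case: (PS i' i'n k).
Qed.

Section GrowthTheory.
Variables (n : nat) (M : nat -> nat -> nat) (L : nat -> nat -> nat -> nat).
Hypothesis gL : growth n M L.

Lemma growth_row_chain i : i <= n -> interlacing_chain n (L i).
Proof.
move=> lin; split=> [k|j jn]; first exact: growth0r gL _ _ lin.
exact: growth_right gL _ _ lin jn.
Qed.

Lemma growth_col_chain j : j <= n -> interlacing_chain n (L^~ j).
Proof.
move=> jn; split=> [k|i lin]; first exact: growth0l gL _ _ jn.
exact: growth_down gL _ _ lin jn.
Qed.

Lemma growth_size_cell i j : i < n -> j < n ->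
  \sum_(k < n) L i.+1 j.+1 k + \sum_(k < n) L i j k =
  \sum_(k < n) L i j.+1 k + \sum_(k < n) L i.+1 j k + M i j.
Proof.
move=> lin jn; have [m nE] : exists m, n = m.+1 by exists n.-1; lia.
have im : i <= m by lia.
under eq_bigr => k _ do rewrite (growth_cell gL lin jn).
rewrite !nE sum_local_rule //.
- exact: growth_right gL _ _ (ltnW lin) jn.
- exact: growth_down gL _ _ lin (ltnW jn).
- by rewrite (chain_support (growth_col_chain jn) (ltnW lin) im) min0n.
Qed.

(** Summing the rectangle rule along a row of cells telescopes, so the step
    sizes on the far sides are the row and column sums of the matrix. *)
Lemma growth_size_row i : i < n ->
  \sum_(k < n) L i.+1 n k = \sum_(k < n) L i n k + \sum_(j < n) M i j.
Proof.
move=> lin.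
suff H j : j <= n ->
    \sum_(k < n) L i.+1 j k = \sum_(k < n) L i j k + \sum_(j' < j) M i j' by exact: H.
elim: j => [|j IH] jn.
  rewrite big_ord0 addn0; apply: eq_bigr => k _.
  by rewrite !(growth0r gL) // ltnW.
have := growth_size_cell lin jn; rewrite (IH (ltnW jn)) big_ord_recr /=; lia.
Qed.

Lemma growth_size_col j : j < n ->
  \sum_(k < n) L n j.+1 k = \sum_(k < n) L n j k + \sum_(i < n) M i j.
Proof.
move=> jn.
suff H i : i <= n ->
    \sum_(k < n) L i j.+1 k = \sum_(k < n) L i j k + \sum_(i' < i) M i' j by exact: H.
elim: i => [|i IH] lin.
  rewrite big_ord0 addn0; apply: eq_bigr => k _.
  by rewrite !(growth0l gL) // ltnW.
have := growth_size_cell lin jn; rewrite (IH (ltnW lin)) big_ord_recr /=; lia.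
Qed.

End GrowthTheory.

(** Inverting the local rule from the far corner backwards recovers every
    partition, and then every matrix entry. *)
Lemma growth_inj n M M' L L' : growth n M L -> growth n M' L' ->
    (forall i, i <= n -> L i n =1 L' i n) -> (forall j, j <= n -> L n j =1 L' n j) ->
  forall i j, i < n -> j < n -> M i j = M' i j.
Proof.
move=> gL gL' eqr eqc.
have cellE N K : growth n N K -> forall i j, i < n -> j < n ->
    K i j =1 local_inverse (K i.+1 j.+1) (K i j.+1) (K i.+1 j).
  move=> gK i j lin jn k; rewrite -(@local_ruleK (K i j) (K i j.+1) (K i.+1 j) (N i j)) //.
  - by rewrite /local_inverse (growth_cell gK).
  - exact: growth_right gK _ _ (ltnW lin) jn.
  - exact: growth_down gK _ _ lin (ltnW jn).
have eqL a b : a <= n -> b <= n -> L (n - a) (n - b) =1 L' (n - a) (n - b).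
  elim: a b => [|a IHa] b an; first by rewrite subn0 => bn; apply: eqc; lia.
  elim: b => [|b IHb] bn; first by rewrite subn0; apply: eqr; lia.
  move=> k; rewrite (cellE _ _ gL) ?(cellE _ _ gL') ?subnSK //; try lia.
  rewrite /local_inverse.
  have E1 := IHa b (ltnW an) (ltnW bn); have E2 := IHa b.+1 (ltnW an) bn.
  have E3 := IHb (ltnW bn).
  by rewrite !E1 !E2 !E3.
have {}eqL i j : i <= n -> j <= n -> L i j =1 L' i j.
  by move=> lin jn; have := eqL (n - i) (n - j); rewrite !subKn //; apply; lia.
move=> i j lin jn.
have := growth_cell gL lin jn 0; have := growth_cell gL' lin jn 0.
by rewrite /= !eqL // ?(ltnW lin) ?(ltnW jn) // => ->; lia.
Qed.

Lemma growth_unique n M L L' : growth n M L -> growth n M L' ->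
  forall i j, i <= n -> j <= n -> L i j =1 L' i j.
Proof.
move=> gL gL'; elim=> [|i IHi] j lin.
  by move=> jn k; rewrite (growth0l gL) ?(growth0l gL').
elim: j => [|j IHj] jn k; first by rewrite (growth0r gL) ?(growth0r gL').
rewrite (growth_cell gL) // (growth_cell gL') //.
have E1 := IHi j (ltnW lin) (ltnW jn); have E2 := IHi j.+1 (ltnW lin) jn.
have E3 := IHj (ltnW jn).
by case: k => [|k]; rewrite /= ?E1 !E2 !E3.
Qed.

(** The diagram is filled backwards by the inverse local rule, in the reversed
    coordinates [n - i] and [n - j].  The partitions on the two near sides come
    out empty because they are contained in the empty ends of the chains. *)
Lemma growth_of_chains n P Q : interlacing_chain n P -> interlacing_chain n Q ->
    P n =1 Q n ->
  exists M L, [/\ growth n M L, forall j, j <= n -> L n j =1 P j &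
                 forall i, i <= n -> L i n =1 Q i].
Proof.
move=> [P0 PS] [Q0 QS] PQ.
(* In the reversed coordinates the two neighbours trade places. *)
pose g (_ _ : nat) p v m := local_inverse p m v.
pose back := fill g (fun j => if j is 0 then Q n else P (n - j)) (fun i => Q (n - i)).
pose L i j := back (n - i) (n - j).
have back0 i : back i 0 = Q (n - i) by rewrite /back fill0 ?subn0.
have b0j j : back 0 j =1 P (n - j) by case: j => [|j] k //=; rewrite subn0 PQ.
pose ge x y := interlace y x.
have Hb : forall i j, i <= n -> j <= n ->
    (j < n -> ge (back i j) (back i j.+1)) /\ (i < n -> ge (back i j) (back i.+1 j)).
  apply: fill_rel; rewrite ?subn0 //.
  - move=> j jn k; have := PS (n - j.+1) _ k; rewrite subnSK // => H.
    by case: j jn H => [|j] jn H /=; rewrite -?PQ; [rewrite subn0 in H|]; apply: H; lia.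
  - by move=> i lin; have := QS (n - i.+1); rewrite subnSK //; apply; lia.
  - move=> i j x y z yx zx; have [] := local_inverse_interlace yx zx.
    rewrite /g /local_inverse /ge => H1 H2.
    by split=> k; [have := H1 k|have := H2 k]; lia.
have Hr i j : i <= n -> j < n -> interlace (L i j) (L i j.+1).
  move=> lin jn; have [] := Hb (n - i) (n - j.+1); try lia.
  by rewrite -/(L i j.+1) -subSn // subSS => + _; apply; lia.
have Hd i j : i < n -> j <= n -> interlace (L i j) (L i.+1 j).
  move=> lin jn; have [] := Hb (n - i.+1) (n - j); try lia.
  by rewrite -/(L i.+1 j) -[(n - i.+1).+1]subSn // subSS => _; apply; lia.
have LP j : j <= n -> L n j =1 P j by move=> jn k; rewrite /L subnn b0j subKn.
have LQ i : i <= n -> L i n =1 Q i by move=> jn k; rewrite /L subnn back0 subKn.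
pose M i j := L i.+1 j.+1 0 - maxn (L i j.+1 0) (L i.+1 j 0).
exists M, L; split=> //; split=> //.
- move=> i j lin jn k; have Lij : L i j = local_inverse (L i.+1 j.+1) (L i j.+1) (L i.+1 j).
    by rewrite /L -(subnSK lin) -(subnSK jn).
  by rewrite Lij local_inverseK //; [exact: Hd i j.+1 lin jn|exact: Hr i.+1 j lin jn].
- move=> j k jn; suff H t : t <= n - j -> L 0 j k <= L 0 (j + t) k.
    by have := H _ (leqnn _); rewrite subnKC // LQ // Q0 leqn0 => /eqP.
  elim: t => [|t IH] tn; first by rewrite addn0.
  rewrite addnS; apply: leq_trans (IH (ltnW tn)) _.
  by case: (Hr 0 (j + t) _ _ k) => //; lia.
- move=> i k lin; suff H t : t <= n - i -> L i 0 k <= L (i + t) 0 k.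
    by have := H _ (leqnn _); rewrite subnKC // LP // P0 leqn0 => /eqP.
  elim: t => [|t IH] tn; first by rewrite addn0.
  rewrite addnS; apply: leq_trans (IH (ltnW tn)) _.
  by case: (Hd (i + t) 0 _ _ k) => //; lia.
Qed.

(** * Ballot sequences of sets and their conjugate chains *)

(** A down-closed set of ordinals is an initial segment. *)
Lemma ltn_card_down d (p : pred 'I_d) : (forall i j : 'I_d, i <= j -> p j -> p i) ->
  forall j : 'I_d, (j < #|[set i | p i]|) = p j.
Proof.
have cardlt m : m <= d -> #|[set i : 'I_d | i < m]| = m.
  by move=> md; rewrite -sum1dep_card (big_ord_narrow md) sum1_card card_ord.
move=> pdown j; apply/idP/idP => [|pj].
  apply: contraLR => pj; rewrite -leqNgt -[leqRHS](cardlt j (ltnW (ltn_ord j))).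
  apply/subset_leq_card/subsetP => i; rewrite !inE; apply: contraLR; rewrite -leqNgt => ji.
  by apply: contra pj; apply: pdown.
rewrite -[leqLHS](cardlt j.+1 (ltn_ord j)).
by apply/subset_leq_card/subsetP => i; rewrite !inE ltnS => /pdown; apply.
Qed.

Section Content.
Variable d : nat.
Implicit Types (A B : seq {set 'I_d}) (j : 'I_d) (S : {set 'I_d}).

Definition content A j := count (fun S => j \in S) A.

Definition partition_shape (f : 'I_d -> nat) : bool :=
  [forall i : 'I_d, forall j : 'I_d, (i <= j) ==> (f j <= f i)].

Definition ballot A : bool :=
  [forall i : 'I_(size A).+1, partition_shape (content (take i A))].

Definition rsets r A := all (fun S : {set 'I_d} => #|S| == r) A.

(** The conjugate of the content: the contents are the column heights, and row
    [k] consists of the columns that are higher than [k]. *)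
Definition row_len A k := #|[set j | k < content A j]|.

Lemma partition_shapeP f :
  reflect (forall i j : 'I_d, i <= j -> f j <= f i) (partition_shape f).
Proof.
apply: (iffP forallP) => [H i j ij|H i]; first by move/forallP: (H i) => /(_ j)/implyP; apply.
by apply/forallP => j; apply/implyP; apply: H.
Qed.

Lemma ballotP A : reflect (forall i, partition_shape (content (take i A))) (ballot A).
Proof.
apply: (iffP forallP) => [H i|H i]; last exact: H.
have [iA|iA] := leqP i (size A); first by have := H (Ordinal (iA : i < (size A).+1)).
by have := H ord_max; rewrite /= take_size take_oversize // ltnW.
Qed.

Lemma ltn_row_len A k j : partition_shape (content A) -> (j < row_len A k) = (k < content A j).
Proof.
move=> /partition_shapeP pA; apply: (ltn_card_down (p := fun j => k < content A j)).
by move=> i i' ii' /leq_trans; apply; apply: pA.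
Qed.

Lemma leq_row_len A k : row_len A k <= d.
Proof. by apply: leq_trans (max_card _) _; rewrite card_ord. Qed.

Lemma content_takeS A i j : i < size A ->
  content (take i.+1 A) j = content (take i A) j + (j \in nth set0 A i).
Proof. by move=> iA; rewrite (take_nth set0) // /content -cats1 count_cat /= addn0. Qed.

Lemma row_len_chain A : interlacing_chain (size A) (fun i => row_len (take i A)).
Proof.
split=> [k|i iA k].
  by rewrite take0 /row_len; apply/eqP; rewrite cards_eq0; apply/eqP/setP => j; rewrite !inE.
by split; apply/subset_leq_card/subsetP => j; rewrite !inE content_takeS //; case: (j \in _); lia.
Qed.

Lemma sum_content A : \sum_j content A j = \sum_(S <- A) #|S|.
Proof.
elim: A => [|S A IH]; first by rewrite big_nil big1.
rewrite big_cons -IH -sum1_card [X in X + _]big_mkcond -big_split /=.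
by apply: eq_bigr => j _; case: (j \in S).
Qed.

Lemma sum_ltn m K : m <= K -> \sum_(k < K) (k < m) = m.
Proof. by move=> mK; rewrite -big_mkcond /= (big_ord_narrow mK) sum1_card card_ord. Qed.

(** Both sides count the boxes of the diagram, by rows and by columns. *)
Lemma sum_row_len A K : size A <= K -> \sum_(k < K) row_len A k = \sum_(S <- A) #|S|.
Proof.
move=> AK; rewrite -(sum_content A).
have E k : row_len A k = \sum_j (k < content A j).
  by rewrite /row_len -sum1dep_card big_mkcond; apply: eq_bigr => j _; case: ltnP.
rewrite (eq_bigr (fun k : 'I_K => \sum_j ((k < content A j) : nat)) (fun k _ => E k)).
rewrite exchange_big /=; apply: eq_bigr => j _.
by rewrite -[RHS](sum_ltn (leq_trans (count_size _ A) AK)).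
Qed.

Lemma sum_card_rsets r A : rsets r A -> \sum_(S <- A) #|S| = r * size A.
Proof.
elim: A => [|S A IH] /=; first by rewrite big_nil muln0.
by move=> /andP[/eqP Sr /IH AE]; rewrite big_cons Sr AE mulnS.
Qed.

Lemma row_len_content A B : partition_shape (content A) -> partition_shape (content B) ->
  row_len A =1 row_len B -> content A =1 content B.
Proof.
move=> pA pB AB j; have E k : (k < content A j) = (k < content B j).
  by rewrite -!ltn_row_len // AB.
by apply/eqP; rewrite eqn_leq; have := E (content A j); have := E (content B j); lia.
Qed.

Lemma content_row_len A B : content A =1 content B -> row_len A =1 row_len B.
Proof. by move=> AB k; rewrite /row_len; under eq_finset do rewrite AB. Qed.

Lemma row_len_inj n A B : size A = n -> size B = n -> ballot A -> ballot B ->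
  (forall i, i <= n -> row_len (take i A) =1 row_len (take i B)) -> A = B.
Proof.
move=> sA sB /ballotP bA /ballotP bB AB.
apply: (@eq_from_nth _ set0) => [|i]; rewrite sA // => lin; apply/setP => j.
have E i' : i' <= n -> content (take i' A) j = content (take i' B) j.
  by move=> i'n; apply: row_len_content => //; apply: AB.
have := E i.+1 lin; rewrite !content_takeS ?sA ?sB // (E i (ltnW lin)) => /addnI.
by do 2 case: (_ \in _).
Qed.

(** Conjugating an interlacing chain gives column heights that grow by 0 or 1 in
    each step; the columns that grow make up the sets. *)
Lemma chain_columns n r (P : nat -> nat -> nat) : interlacing_chain n P ->
    (forall i, i < n -> \sum_(k < n) P i.+1 k = \sum_(k < n) P i k + r) -> P n 0 <= d ->
  exists A, [/\ size A = n, rsets r A, ballot A &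
                forall i, i <= n -> row_len (take i A) =1 P i].
Proof.
move=> cP Psum Pd; have [P0 PS] := cP.
have Pdec i k : i <= n -> P i k.+1 <= P i k.
  by case: i => [|i] lin; [rewrite !P0|case: (PS i lin k); lia].
pose c i j := #|[set k : 'I_n | j < P i k]|.
have Pmono i k k' : i <= n -> k <= k' -> P i k' <= P i k.
  move=> lin; elim: k' => [|k' IH]; first by rewrite leqn0 => /eqP->.
  rewrite leq_eqVlt => /predU1P[->//|kk']; exact: leq_trans (Pdec _ _ lin) (IH kk').
have cP' i k j : i <= n -> (k < c i j) = (j < P i k).
  move=> lin; have [kn|nk] := ltnP k n.
    apply: (@ltn_card_down n (fun k : 'I_n => j < P i k) _ (Ordinal kn)).
    by move=> x y xy /leq_trans; apply; apply: Pmono.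
  rewrite (chain_support cP lin (leq_trans lin nk)) ltn0; apply/negbTE; rewrite -leqNgt.
  by apply: leq_trans (max_card _) _; rewrite card_ord.
pose A := mkseq (fun i => [set j : 'I_d | c i j < c i.+1 j]) n; exists A.
have sA : size A = n by rewrite size_mkseq.
have ctA i j : i <= n -> content (take i A) j = c i j.
  elim: i => [|i IH] lin.
    rewrite take0 /=; apply/esym/eqP; rewrite cards_eq0; apply/eqP/setP => k.
    by rewrite !inE P0.
  rewrite content_takeS ?sA // IH ?(ltnW lin) // nth_mkseq // inE.
  have c1 : c i j <= c i.+1 j.
    by apply/subset_leq_card/subsetP => k; rewrite !inE; case: (PS i lin k); lia.
  suff : c i.+1 j <= (c i j).+1 by case: ltnP; lia.
  rewrite leqNgt cP' //; apply/negP => H; have := cP' i (c i j) j (ltnW lin); rewrite ltnn.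
  by case: (PS i lin (c i j)); lia.
have bA : ballot A.
  apply/forallP => -[i /=]; rewrite sA ltnS => lin; apply/partition_shapeP => j j' jj'.
  rewrite !ctA //; apply/subset_leq_card/subsetP => k; rewrite !inE.
  by apply: leq_ltn_trans.
have rA i : i <= n -> row_len (take i A) =1 P i.
  move=> lin k; rewrite /row_len; under eq_finset do rewrite ctA // cP' //.
  have PD : P i k <= d.
    by apply: leq_trans (chain_mono cP k lin (leqnn n)) _; apply: leq_trans Pd; apply: Pmono.
  by rewrite -sum1dep_card (big_ord_narrow PD) sum1_card card_ord.
split=> //; apply/allP => S /(nthP set0)[i]; rewrite sA => lin <-; apply/eqP.
have := Psum i lin.
have E i' : i' <= n -> \sum_(k < n) P i' k = \sum_(S <- take i' A) #|S|.
  move=> i'n; rewrite -(@sum_row_len _ n) ?size_take ?sA; last by case: ifP; lia.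
  by apply: eq_bigr => k _; rewrite rA.
rewrite !E ?(ltnW lin) // (take_nth set0) ?sA // -cats1 big_cat big_seq1.
exact: addnI.
Qed.

End Content.

Definition ballot_pairs n d r :=
  [set p : n.-tuple {set 'I_d} * n.-tuple {set 'I_d} |
     [&& rsets r p.1, rsets r p.2, ballot p.1, ballot p.2
       & [forall j, content p.1 j == content p.2 j]]].

(** * Multigraphs and last passage *)

Section LastPassage.
Variables (n r : nat) (G : multigraph n r).
Implicit Types (E F : {set edge n r}).

Definition mult i j : nat :=
  if (insub i, insub j) is (Some u, Some v) then (G (u, v) : nat) else 0.

Lemma multE (u v : 'I_n) : mult u v = G (u, v).
Proof. by rewrite /mult !valK. Qed.

Definition within i j E := [forall e : edge n r in E, (e.1.1 < i) && (e.1.2 < j)].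

Lemma withinP i j E :
  reflect {in E, forall e : edge n r, e.1.1 < i /\ e.1.2 < j} (within i j E).
Proof.
by apply: (iffP forall_inP) => H e eE; move: (H e eE) => /andP.
Qed.

Definition parallel (u v : 'I_n) := [set e in edges G | e.1 == (u, v)].

Lemma card_parallel u v : #|parallel u v| = G (u, v).
Proof.
have Gr : G (u, v) <= r by rewrite -ltnS.
transitivity #|[set k : 'I_r | k < G (u, v)]|; last first.
  by rewrite -sum1dep_card (big_ord_narrow Gr) sum1_card card_ord.
rewrite -(card_imset (f := fun k : 'I_r => (u, v, k))); last by move=> k k' [].
apply: eq_card => -[[u' v'] k]; rewrite !inE /=.
apply/andP/imsetP => [[kG /eqP E]|[k' + [-> -> ->]]].
  by exists k; rewrite ?inE -E.
by rewrite inE.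
Qed.

Lemma pairwise_noncrossingP E :
  reflect {in E &, forall e f, e != f -> noncrossing e f} (pairwise_noncrossing E).
Proof.
apply: (iffP forall_inP) => [H e f eE fE|H e eE].
  by move/forall_inP: (H e eE) => /(_ f fE)/implyP.
by apply/forall_inP => f fE; apply/implyP; apply: H.
Qed.

Lemma pairwise_noncrossing_sub E F :
  F \subset E -> pairwise_noncrossing E -> pairwise_noncrossing F.
Proof.
move=> /subsetP FE /pairwise_noncrossingP H; apply/pairwise_noncrossingP => e f eF fF.
by apply: H; apply: FE.
Qed.

Variables (L : nat -> nat -> nat -> nat).
Hypothesis gL : growth n mult L.

(** Apart from the copies of the edge in the last cell, a noncrossing set cannot
    use both the last row and the last column: an edge in the last row and an
    edge in the last column would cross.  Hence the rest is counted by one of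
    the two neighbouring points. *)
Lemma noncrossing_leq i j E : i <= n -> j <= n ->
  E \subset edges G -> pairwise_noncrossing E -> within i j E -> #|E| <= L i j 0.
Proof.
elim: i j E => [|i IHi] j E.
  move=> _ jn _ _ /withinP H; rewrite (growth0l gL) // leqn0 cards_eq0; apply/eqP/setP => e.
  by rewrite inE; apply/negP => /H[].
elim: j E => [|j IHj] E lin jn EG ncE /withinP Eij.
  rewrite (growth0r gL) // leqn0 cards_eq0; apply/eqP/setP => e.
  by rewrite inE; apply/negP => /Eij[].
pose u := Ordinal lin; pose v := Ordinal jn.
rewrite (growth_cell gL) //= -[mult i j]/(mult u v) multE -card_parallel.
rewrite -(cardsID (parallel u v) E) addnC; apply: leq_add; last first.
  by apply: subset_leq_card; apply: subsetIr.
set F := E :\: _; have FE : F \subset E by apply: subsetDl.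
have FG := subset_trans FE EG; have ncF := pairwise_noncrossing_sub FE ncE.
have Fuv (e : edge n r) : e \in F -> ~ (e.1.1 = i :> nat /\ e.1.2 = j :> nat).
  rewrite !inE => /andP[+ eE] [ei ej].
  have := subsetP EG e eE; rewrite inE => -> /=; case: e {eE} ei ej => -[u' v'] k /= ui vj.
  by rewrite xpair_eqE -!val_eqE /= ui vj !eqxx.
have Fij (e : edge n r) : e \in F -> e.1.1 <= i /\ e.1.2 <= j by move=> /(subsetP FE)/Eij; lia.
rewrite leq_max; have [|] := boolP (within i j.+1 F).
  by move=> Fin; rewrite IHi // ltnW.
rewrite negb_forall => /existsP[e]; rewrite negb_imply => /andP[eF ne].
rewrite [X in _ || X]IHj ?orbT //; first exact: ltnW.
apply/withinP => f fF; have [f1 f2] := Fij f fF; have [e1 e2] := Fij e eF.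
have eu := Fuv e eF; have fu := Fuv f fF; split; first by [].
have ef : e != f -> noncrossing e f by move/pairwise_noncrossingP: ncF; apply.
have [E1|/ef] := eqVneq e f; first by subst f; lia.
rewrite /noncrossing; lia.
Qed.

(** The copies of the edge in the last cell are noncrossing with every edge of
    the rectangle, so they can be added to a largest set of the better of the two
    neighbours. *)
Lemma noncrossing_attained i j : i <= n -> j <= n ->
  exists E, [/\ E \subset edges G, pairwise_noncrossing E, within i j E & #|E| = L i j 0].
Proof.
have E0 i' j' : L i' j' 0 = 0 ->
    exists E, [/\ E \subset edges G, pairwise_noncrossing E, within i' j' E &
                  #|E| = L i' j' 0].
  move=> ->; exists set0; split; rewrite ?sub0set ?cards0 //.
    by apply/pairwise_noncrossingP => e f; rewrite inE.
  by apply/withinP => e; rewrite inE.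
elim: i j => [|i IHi] j; first by move=> _ jn; apply: E0; apply: growth0l gL _ _ jn.
elim: j => [|j IHj] lin jn; first by apply: E0; apply: growth0r gL _ _ lin.
pose u := Ordinal lin; pose v := Ordinal jn.
have [E [EG ncE Ein EL]] : exists E, [/\ E \subset edges G, pairwise_noncrossing E,
    within i.+1 j.+1 E /\ [disjoint E & parallel u v] &
    #|E| = maxn (L i j.+1 0) (L i.+1 j 0)].
  have [_|_] := leqP (L i j.+1 0) (L i.+1 j 0).
    have [E [EG ncE /withinP Ein EL]] := IHj lin (ltnW jn); exists E; split=> //; split.
      by apply/withinP => e /Ein; lia.
    rewrite disjoint_subset; apply/subsetP => e /Ein[_ ej]; rewrite !inE negb_and.
    by apply/orP; right; apply: contraTneq ej => ->; rewrite ltnn.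
  have [E [EG ncE /withinP Ein EL]] := IHi j.+1 (ltnW lin) jn; exists E; split=> //; split.
    by apply/withinP => e /Ein; lia.
  rewrite disjoint_subset; apply/subsetP => e /Ein[ei _]; rewrite !inE negb_and.
  by apply/orP; right; apply: contraTneq ei => ->; rewrite ltnn.
have [/withinP Ew dE] := Ein.
exists (E :|: parallel u v); split.
- by rewrite subUset EG; apply/subsetP => e; rewrite inE => /andP[].
- apply/pairwise_noncrossingP => e f; rewrite !inE.
  have Pe (x : edge n r) : (x \in E) || (x.2 < G x.1) && (x.1 == (u, v)) ->
      x.1.1 <= i /\ x.1.2 <= j.
    by move=> /orP[/Ew|/andP[_ /eqP->]] //=; lia.
  move=> eP fP; have := Pe e eP; have := Pe f fP.
  move: eP fP => /orP[eE|/andP[_ /eqP eu]] /orP[fE|/andP[_ /eqP fu]] Hf He.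
  + by move/pairwise_noncrossingP: ncE; apply.
  + by rewrite /noncrossing fu /=; lia.
  + by rewrite /noncrossing eu /=; lia.
  + by rewrite /noncrossing eu fu /= !leqnn.
- apply/withinP => e; rewrite !inE => /orP[/Ew//|/andP[_ /eqP->]] /=; lia.
- rewrite (growth_cell gL) //= -[mult i j]/(mult u v) multE -card_parallel -EL.
  by apply/eqP; rewrite (leq_card_setU E (parallel u v)).2.
Qed.

Lemma noncrossing_bound d :
  [forall E : {set edge n r}, (E \subset edges G) && pairwise_noncrossing E ==> (#|E| <= d)]
  = (L n n 0 <= d).
Proof.
apply/forallP/idP => [H|Ld E].
  have [E [EG ncE _ <-]] := noncrossing_attained (leqnn n) (leqnn n).
  by move/implyP: (H E); rewrite EG ncE; apply.
apply/implyP => /andP[EG ncE]; apply: leq_trans Ld; apply: noncrossing_leq => //.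
by apply/withinP => e _; rewrite !ltn_ord.
Qed.

End LastPassage.

(** A multigraph is related to the pair of sequences whose row lengths are the
    partitions on the two far sides of its growth diagram. *)
Lemma ghat_ballot_pairs n d r : ghat n d r = #|ballot_pairs n d r|.
Proof.
pose R (G : multigraph n r) (p : n.-tuple {set 'I_d} * n.-tuple {set 'I_d}) :=
  exists L, growth n (mult G) L /\ forall i, i <= n ->
    row_len (take i p.1) =1 L n i /\ row_len (take i p.2) =1 L i n.
have tk (A : n.-tuple {set 'I_d}) : take n A = A by rewrite take_oversize // size_tuple.
apply: (@card_rel _ _ R).
- move=> G; rewrite inE => /andP[/andP[/forallP Gu /forallP Gv]].
  have [L gL] := growth_exists n (mult G); rewrite (noncrossing_bound gL) => Ld.
  have [] := @chain_columns d n r (L n) _ _ Ld; first exact: growth_row_chain gL _ (leqnn n).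
    move=> j jn; rewrite (growth_size_col gL jn); congr (_ + _).
    by rewrite -[RHS](eqP (Gv (Ordinal jn))); apply: eq_bigr => i _; rewrite -multE.
  move=> A [sA rA bA EA].
  have [] := @chain_columns d n r (L^~ n) _ _ Ld; first exact: growth_col_chain gL _ (leqnn n).
    move=> i lin; rewrite (growth_size_row gL lin); congr (_ + _).
    by rewrite -[RHS](eqP (Gu (Ordinal lin))); apply: eq_bigr => j _; rewrite -multE.
  move=> B [sB rB bB EB].
  exists (tcast sA (in_tuple A), tcast sB (in_tuple B)); last first.
    by exists L; split=> // i lin /=; rewrite !val_tcast; split; [apply: EA|apply: EB].
  rewrite inE /= !val_tcast rA rB bA bB /=; apply/forallP => j; apply/eqP.
  have tA : take n A = A by rewrite -sA take_size.
  have tB : take n B = B by rewrite -sB take_size.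
  apply: row_len_content; first by rewrite -tA; apply/ballotP.
    by rewrite -tB; apply/ballotP.
  by rewrite -{1}tA -tB => k; rewrite EA // EB.
- move=> [A B]; rewrite inE /= => /and5P[rA rB bA bB /forallP AB].
  have cA := row_len_chain A; have cB := row_len_chain B; rewrite !size_tuple in cA cB.
  have sumr (C : n.-tuple {set 'I_d}) i : rsets r C -> i < n ->
      \sum_(k < n) row_len (take i.+1 C) k = \sum_(k < n) row_len (take i C) k + r.
    move=> rC lin; rewrite !sum_row_len ?size_take ?size_tuple; try by case: ifP; lia.
    rewrite (take_nth set0) ?size_tuple // -cats1 big_cat big_seq1 /=; congr (_ + _).
    by apply/eqP; apply: (allP rC); rewrite mem_nth // size_tuple.
  have [|M [L [gL LA LB]]] := growth_of_chains cA cB.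
    by rewrite !tk; apply: content_row_len => j; apply/eqP.
  have sumrow i : i < n -> \sum_(j < n) M i j = r.
    move=> lin; apply/(@addnI (\sum_(k < n) L i n k)); rewrite -(growth_size_row gL) //.
    under eq_bigr => k _ do rewrite LB //.
    by rewrite (sumr B) //; congr (_ + _); apply: eq_bigr => k _; rewrite LB // ltnW.
  have sumcol j : j < n -> \sum_(i < n) M i j = r.
    move=> jn; apply/(@addnI (\sum_(k < n) L n j k)); rewrite -(growth_size_col gL) //.
    under eq_bigr => k _ do rewrite LA //.
    by rewrite (sumr A) //; congr (_ + _); apply: eq_bigr => k _; rewrite LA // ltnW.
  pose G : multigraph n r := [ffun uv : 'I_n * 'I_n => inord (M uv.1 uv.2)].
  have GE (u v : 'I_n) : G (u, v) = M u v :> nat.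
    by rewrite ffunE inordK // ltnS -[leqRHS](sumrow u) // (bigD1 v) //= leq_addr.
  have ME i j : i < n -> j < n -> mult G i j = M i j.
    by move=> lin jn; rewrite -[mult _ _ _]/(mult G (Ordinal lin) (Ordinal jn)) multE GE.
  have gG : growth n (mult G) L.
    by case: gL => L1 L2 L3 L4 L5; split=> // i j lin jn; rewrite ME //; apply: L3.
  exists G.
    rewrite inE (noncrossing_bound gG) LA // tk leq_row_len andbT.
    apply/andP; split; apply/forallP => u; apply/eqP.
      by rewrite -[RHS](sumrow u) //; apply: eq_bigr => v _; rewrite GE.
    by rewrite -[RHS](sumcol u) //; apply: eq_bigr => v _; rewrite GE.
  by exists L; split=> // i lin /=; split=> k; rewrite ?LA ?LB.
- move=> G G' p _ _ [L [gL LE]] [L' [gL' L'E]].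
  have H := growth_inj gL gL' _ _.
  apply/ffunP => -[u v]; apply/val_inj => /=; rewrite -!multE; apply: H => // i lin k.
    by rewrite -(LE _ lin).2 (L'E _ lin).2.
  by rewrite -(LE _ lin).1 (L'E _ lin).1.
- move=> G [A B] [A' B']; rewrite !inE /= => /and5P[_ _ bA bB _] /and5P[_ _ bA' bB' _].
  move=> [L [gL LE]] [L' [gL' L'E]]; have LL := growth_unique gL gL'.
  congr (_, _); apply/val_inj => /=; apply: (@row_len_inj _ n); rewrite ?size_tuple // => i lin k.
    by rewrite (LE _ lin).1 (L'E _ lin).1 LL.
  by rewrite (LE _ lin).2 (L'E _ lin).2 LL.
Qed.

(** * Tableaux *)

Lemma ltn_count_sorted (s : seq nat) m j : sorted ltn s ->
  (j < count (fun x => x <= m) s) = (j < size s) && (nth 0 s j <= m).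
Proof.
elim: s j => [|x s IH] j //= xs.
have ss : sorted ltn s := path_sorted xs.
have [xm|mx] := leqP x m; first by case: j => [|j] /=; rewrite ?xm // add1n !ltnS IH.
have lts : all (fun y => m < y) s.
  by apply: sub_all (order_path_min ltn_trans xs) => y; apply: ltn_trans.
have -> : count (fun y => y <= m) s = 0.
  by apply/eqP; rewrite -leqn0 leqNgt -has_count -all_predC; apply: sub_all lts => y /=; lia.
rewrite addn0 ltn0; apply/esym/negbTE; rewrite negb_and -leqNgt -ltnNge.
case: j => [|j] /=; first by rewrite mx.
by rewrite ltnS; have [js|//] := ltnP j (size s); rewrite (allP lts) ?mem_nth.
Qed.

Lemma find_mem_flatten (t : seq (seq nat)) k x :
  uniq (flatten t) -> x \in nth [::] t k -> row_of x t = k.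
Proof.
elim: t k => [|s t IH] [|k] //=; rewrite /row_of /=; first by move=> _ ->.
rewrite cat_uniq => /and3P[_ dis ut] xk; have -> : x \in s = false.
  apply: contraNF dis => xs; apply/hasP; exists x => //=.
  apply/flattenP; exists (nth [::] t k) => //; rewrite mem_nth // ltnNge.
  by apply: contraTN xk => /(nth_default [::])->.
by rewrite -/(row_of x t) (IH k).
Qed.

Lemma row_of_block n r t i x y : row_condition n r t -> i < n ->
    r * i < x -> x <= y -> y <= r * i.+1 ->
  row_of y t <= row_of x t.
Proof.
move=> tr lin rx; elim: y => [|y IH] xy yr; first by move: rx xy; lia.
move: xy; rewrite leq_eqVlt => /predU1P[->//|xy].
apply: leq_trans (IH xy (ltnW yr)).
have sr : y - r * i < r by rewrite mulnS in yr; lia.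
have := forallP (forallP tr (Ordinal lin)) (Ordinal sr) => /= /implyP.
by rewrite subnKC ?addn1; [apply; lia|lia].
Qed.

Section TableauRows.
Variables (n d r : nat) (t : seq (seq nat)).
Hypothesis tT : in_T (r * n) d t.

Local Notation row k := (nth [::] t k).
Definition row_count (u : seq (seq nat)) m k := count (fun x => x <= m) (nth [::] u k).

Lemma perm_entries : perm_eq (flatten t) (iota 1 (r * n)).
Proof. by case/and3P: tT. Qed.

Lemma uniq_entries : uniq (flatten t).
Proof. by rewrite (perm_uniq perm_entries) iota_uniq. Qed.

Lemma row_sorted k : sorted ltn (row k).
Proof.
have [kt|tk] := ltnP k (size t); last by rewrite nth_default.
by case/and3P: tT => /and5P[_ _ /allP H _ _] _ _; apply/H/mem_nth.
Qed.

Lemma row_size k : size (row k) <= d.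
Proof.
have [kt|tk] := ltnP k (size t); last by rewrite nth_default.
by case/and3P: tT => _ _ /allP H; apply/H/mem_nth.
Qed.

Lemma row_nonempty k : (0 < size (row k)) = (k < size t).
Proof.
have [kt|tk] := ltnP k (size t); last by rewrite nth_default.
by case/and3P: tT => /and5P[/allP H _ _ _ _] _ _; rewrite lt0n size_eq0; apply/H/mem_nth.
Qed.

Lemma row_size_dec k : size (row k.+1) <= size (row k).
Proof.
have [kt|tk] := ltnP k.+1 (size t); last by rewrite nth_default.
case/and3P: tT => /and5P[_ /(sortedP 0) H _ _ _] _ _.
by have := H k; rewrite size_map => /(_ kt); rewrite !(nth_map [::]) // ltnW.
Qed.

Lemma row_column k j : j < size (row k.+1) -> nth 0 (row k) j < nth 0 (row k.+1) j.
Proof.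
have [kt|tk] := ltnP k.+1 (size t); last by rewrite (nth_default _ tk).
case/and3P: tT => /and5P[_ _ _ /(sortedP [::])/(_ k kt)/allP H _] _ _ js.
by apply: H; rewrite mem_iota.
Qed.

Lemma mem_row x k : (x \in row k) = (0 < x <= r * n) && (row_of x t == k).
Proof.
apply/idP/andP => [xk|[xn /eqP<-]].
  rewrite (find_mem_flatten uniq_entries xk) eqxx; split=> //.
  have : x \in flatten t.
    apply/flattenP; exists (row k) => //; rewrite mem_nth // ltnNge.
    by apply: contraTN xk => /(nth_default [::])->.
  by rewrite (perm_mem perm_entries) mem_iota; lia.
have : x \in flatten t by rewrite (perm_mem perm_entries) mem_iota; lia.
by move=> /flattenP[s st xs]; apply: (@nth_find _ [::] (fun s => x \in s)); apply/hasP; exists s.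
Qed.

Lemma row_countS m k : m < r * n ->
  row_count t m.+1 k = row_count t m k + (row_of m.+1 t == k).
Proof.
move=> mn; have := mem_row m.+1 k; rewrite /= mn /= => <-.
rewrite -(count_uniq_mem _ (sorted_uniq ltn_trans ltnn (row_sorted k))) /row_count.
rewrite -count_predUI [X in _ + X](eq_count (a2 := pred0)) ?count_pred0 ?addn0.
  by apply: eq_count => x /=; lia.
by move=> x /=; lia.
Qed.

Lemma row_count0 k : row_count t 0 k = 0.
Proof.
apply/eqP; rewrite -leqn0 leqNgt -has_count; apply/hasPn => x.
by rewrite mem_row => /andP[/andP[x0 _] _]; rewrite -ltnNge.
Qed.

Lemma row_count_mono m m' k : m <= m' -> row_count t m k <= row_count t m' k.
Proof. by move=> mm'; apply: sub_count => x /= /leq_trans; apply. Qed.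

Lemma row_count_all k : row_count t (r * n) k = size (row k).
Proof.
apply/eqP; rewrite -all_count; apply/allP => x.
by rewrite mem_row => /andP[/andP[]].
Qed.

Lemma sum_row_count m K : m <= r * n -> size t <= K -> \sum_(k < K) row_count t m k = m.
Proof.
move=> mn tK; elim: m mn => [|m IH] mn.
  by rewrite big1 // => k _; rewrite row_count0.
under eq_bigr => k _ do rewrite row_countS //.
rewrite big_split /= IH ?(ltnW mn) // -[RHS]addn1; congr (_ + _).
have rt : row_of m.+1 t < size t.
  have := mem_row m.+1 (row_of m.+1 t); rewrite /= mn eqxx /=; apply: contraTT.
  by rewrite -leqNgt => /(nth_default [::])->.
rewrite (bigD1 (Ordinal (leq_trans rt tK))) //= eqxx big1 // => k kn.
by apply/eqP; rewrite eqb0 eq_sym; apply: contra_neq kn => H; apply/val_inj.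
Qed.

Hypothesis tr : row_condition n r t.

(** If two entries of one block were in the same column, the column condition
    would put the larger one strictly below, against the row condition.  So the
    entries of a block form a horizontal strip. *)
Lemma row_count_chain : interlacing_chain n (fun i => row_count t (r * i)).
Proof.
split=> [k|i lin k]; first by rewrite muln0 row_count0.
split; first by apply: row_count_mono; rewrite leq_mul2l leqnSn orbT.
(* The first position in row k whose entry exceeds r * i. *)
set j := row_count t (r * i) k; rewrite leqNgt ltn_count_sorted ?row_sorted //.
apply/negP => /andP[js yr]; set y := nth 0 _ j in yr.
have xy := row_column js; set x := nth 0 _ j in xy.
have js' := leq_trans js (row_size_dec k).
have : ~~ (j < row_count t (r * i) k) by rewrite ltnn.
rewrite ltn_count_sorted ?row_sorted // js' /= -ltnNge => rx.
have := row_of_block tr lin rx (ltnW xy) yr.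
rewrite (find_mem_flatten uniq_entries (mem_nth 0 js')).
by rewrite (find_mem_flatten uniq_entries (mem_nth 0 js)) ltnn.
Qed.

Lemma tableau_columns : exists A : seq {set 'I_d},
  [/\ size A = n, rsets r A, ballot A &
      forall i, i <= n -> row_len (take i A) =1 row_count t (r * i)].
Proof.
apply: chain_columns; first exact: row_count_chain; last first.
  by rewrite row_count_all row_size.
have S i : i <= n -> \sum_(k < n) row_count t (r * i) k = r * i.
  (* The chain has at most n rows, so padding to n + size t rows adds nothing. *)
  move=> lin; rewrite -[RHS](@sum_row_count _ (n + size t)) ?leq_addl //; last first.
    by rewrite leq_mul2l lin orbT.
  rewrite big_split_ord /= [X in _ + X]big1 ?addn0 // => k _.
  by apply: (chain_support row_count_chain) => //; apply: leq_trans lin _; apply: leq_addr.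
by move=> i lin; rewrite !S ?(ltnW lin) // mulnSr.
Qed.

End TableauRows.

(** Suppose that [m.+1] lies lower in [t] than in [t'], in row [k] say.  After
    [m.+1] the rows in [t'] only move up within the block, so row [k] of [t']
    receives no further entry of the block, while row [k] of [t] has received
    one; but at the end of the block both rows hold equally many entries. *)
Lemma row_of_leq n d r t t' m :
    in_T (r * n) d t -> in_T (r * n) d t' -> row_condition n r t' -> m < r * n ->
    (forall i, i <= n -> row_count t (r * i) =1 row_count t' (r * i)) ->
    row_count t m =1 row_count t' m ->
  row_of m.+1 t <= row_of m.+1 t'.
Proof.
move=> tT tT' tr' mn tt' mE; rewrite leqNgt; apply/negP => lt_row.
set k := row_of m.+1 t in lt_row.
have r0 : 0 < r by rewrite lt0n; apply: contraTneq mn => ->.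
pose i := m %/ r; have im : r * i <= m by rewrite mulnC leq_divM.
have mi : m < r * i.+1 by rewrite mulnC ltn_ceil.
have lin : i < n by rewrite ltn_divLR // mulnC.
have C y : m <= y -> y <= r * i.+1 -> row_count t' y k = row_count t' m k.
  elim: y => [|y IH]; first by rewrite leqn0 => /eqP->.
  rewrite leq_eqVlt => /predU1P[->//|my] yi.
  rewrite (row_countS tT'); last by apply: leq_trans yi _; rewrite leq_mul2l lin orbT.
  rewrite IH // ?(ltnW yi) //; have := row_of_block tr' lin (x := m.+1) (y := y.+1).
  move=> /(_ im my yi) H; rewrite [_ == _](_ : _ = false) ?addn0 //.
  by apply/negP => /eqP E; move: H; rewrite E leqNgt lt_row.
have := row_count_mono t k mi; rewrite (row_countS tT) // eqxx mE -(C _ (ltnW mi) (leqnn _)).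
by rewrite tt' // addn1 ltnn.
Qed.

Section TableauUnique.
Variables (n d r : nat) (t t' : seq (seq nat)).
Hypotheses (tT : in_T (r * n) d t) (tT' : in_T (r * n) d t').

Lemma tableau_size_eq :
  (forall k, size (nth [::] t k) = size (nth [::] t' k)) -> size t = size t'.
Proof.
move=> H; apply/eqP; rewrite eqn_leq leqNgt -(row_nonempty tT) H (row_nonempty tT') ltnn.
by rewrite leqNgt -(row_nonempty tT') -H (row_nonempty tT) ltnn.
Qed.

Lemma shape_eq :
  (forall k, size (nth [::] t k) = size (nth [::] t' k)) -> shape t = shape t'.
Proof.
move=> H; have st := tableau_size_eq H.
by apply: (@eq_from_nth _ 0); rewrite ?size_map // => k kt; rewrite !(nth_map [::]) -?st.
Qed.

Hypotheses (tr : row_condition n r t) (tr' : row_condition n r t').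

Lemma tableau_unique :
  (forall i, i <= n -> row_count t (r * i) =1 row_count t' (r * i)) -> t = t'.
Proof.
move=> tt'.
have E m : m <= r * n -> row_count t m =1 row_count t' m.
  elim: m => [_ k|m IH mn k]; first by rewrite (row_count0 tT) (row_count0 tT').
  rewrite (row_countS tT) // (row_countS tT') // IH ?(ltnW mn) //; congr (_ + (_ == _)).
  apply/eqP; rewrite eqn_leq (row_of_leq tT tT' tr') ?(row_of_leq tT' tT tr) //.
  - by move=> i lin k'; rewrite tt'.
  - by move=> k'; rewrite IH // ltnW.
  - exact: IH (ltnW mn).
have R k : nth [::] t k = nth [::] t' k.
  apply: (irr_sorted_eq ltn_trans ltnn (row_sorted tT k) (row_sorted tT' k)) => x.
  rewrite (mem_row tT) (mem_row tT'); case: x => [|m] //=; case: (ltnP m (r * n)) => //= mn.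
  have := E m.+1 mn k; rewrite (row_countS tT) // (row_countS tT') // E ?(ltnW mn) //.
  by move/addnI; do 2 case: (_ == k).
apply: (@eq_from_nth _ [::]) => //.
by apply: tableau_size_eq => k; rewrite R.
Qed.

End TableauUnique.

Section Build.
Variables (n d r : nat) (A : seq {set 'I_d}).
Implicit Types (i : 'I_d).

(** The step in which the box in row [k] and column [i] is added: the number of
    prefixes after which column [i] is still too low. *)
Definition arrival k i := #|[set m : 'I_n | content (take m.+1 A) i <= k]|.

Definition rank (S : {set 'I_d}) i := #|[set j in S | j < i]|.

(** The boxes added in one step are numbered from left to right. *)
Definition entry k i := r * arrival k i + rank (nth set0 A (arrival k i)) i + 1.

Lemma content_take_leq m m' i : m <= m' -> content (take m A) i <= content (take m' A) i.
Proof.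
move=> mm'; rewrite -(subnKC mm') takeD /content count_cat; exact: leq_addr.
Qed.

Lemma rank_ltn (S : {set 'I_d}) i : i \in S -> rank S i < #|S|.
Proof.
move=> iS; apply/proper_card/properP; split; first by apply/subsetP => j; rewrite inE => /andP[].
by exists i => //; rewrite inE ltnn andbF.
Qed.

Lemma rank_ltn_mono (S : {set 'I_d}) i (j : 'I_d) : i \in S -> i < j -> rank S i < rank S j.
Proof.
move=> iS ij; apply/proper_card/properP; split.
  by apply/subsetP => k; rewrite !inE => /andP[-> ki]; apply: ltn_trans ij.
by exists i; rewrite inE ?iS // ltnn.
Qed.

Lemma rank_inj (S : {set 'I_d}) i (j : 'I_d) :
  i \in S -> j \in S -> rank S i = rank S j -> i = j.
Proof.
move=> iS jS; have [/(rank_ltn_mono iS)|/(rank_ltn_mono jS)|/val_inj//] := ltngtP i j; lia.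
Qed.

Lemma block_unique a b x :
  r * a < x -> x <= r * a.+1 -> r * b < x -> x <= r * b.+1 -> a = b.
Proof.
move=> a1 a2 b1 b2; apply/eqP; rewrite eqn_leq.
have := leq_trans a1 b2; have := leq_trans b1 a2; rewrite !ltn_mul2l !ltnS.
by move=> /andP[_ ->] /andP[_ ->].
Qed.

Hypotheses (sA : size A = n) (rA : rsets r A) (bA : ballot A).

Lemma arrival_lt m k i : m <= n -> (arrival k i < m) = (k < content (take m A) i).
Proof.
case: m => [|m] mn; first by rewrite take0.
have down (a b : 'I_n) : a <= b -> content (take b.+1 A) i <= k -> content (take a.+1 A) i <= k.
  by move=> ab; apply: leq_trans; apply: content_take_leq.
have E : (m < arrival k i) = (content (take m.+1 A) i <= k) := ltn_card_down down (Ordinal mn).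
by rewrite ltnS leqNgt E -ltnNge.
Qed.

Lemma arrival_ltn k i : k < content A i -> arrival k i < n.
Proof. by rewrite arrival_lt // -sA take_size. Qed.

Lemma arrivalP k i : k < content A i ->
  i \in nth set0 A (arrival k i) /\ content (take (arrival k i) A) i = k.
Proof.
move=> ki; have an := arrival_ltn ki.
have := arrival_lt k i (ltnW an); have := arrival_lt k i an.
rewrite ltnn ltnSn content_takeS ?sA //; case: (_ \in _); lia.
Qed.

Lemma card_nth m : m < n -> #|nth set0 A m| = r.
Proof. by move=> mn; apply/eqP; apply: (allP rA); rewrite mem_nth ?sA. Qed.

Lemma entry_block k i : k < content A i ->
  r * arrival k i < entry k i <= r * (arrival k i).+1.
Proof.
move=> ki; have [iS _] := arrivalP ki; have := rank_ltn iS.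
by rewrite card_nth ?arrival_ltn // /entry mulnS; lia.
Qed.

Lemma entry_leq m k i : m <= n -> k < content A i ->
  (entry k i <= r * m) = (k < content (take m A) i).
Proof.
move=> mn ki; have /andP[lo hi] := entry_block ki; rewrite -arrival_lt //.
have [am|ma] := ltnP (arrival k i) m.
  by apply: leq_trans hi _; rewrite leq_mul2l am orbT.
by apply/negbTE; rewrite -ltnNge; apply: leq_ltn_trans lo; rewrite leq_mul2l ma orbT.
Qed.

Lemma entry_inj k i k' i' : k < content A i -> k' < content A i' ->
  entry k i = entry k' i' -> k = k' /\ i = i'.
Proof.
move=> ki ki' E; have /andP[l1 u1] := entry_block ki; have /andP[l2 u2] := entry_block ki'.
rewrite -E in l2 u2; have aa := block_unique l1 u1 l2 u2.
have [iS kE] := arrivalP ki; have [iS' kE'] := arrivalP ki'.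
move: E; rewrite /entry -aa; rewrite -aa in iS' kE'.
move=> /eqP; rewrite !addn1 eqSS eqn_add2l => /eqP/(rank_inj iS iS') ii'.
by split=> //; rewrite -kE -kE' ii'.
Qed.

Lemma entry_row k i (j : 'I_d) : k < content A j -> i < j -> entry k i < entry k j.
Proof.
move=> kj ij; have pA m := partition_shapeP _ (elimT (ballotP A) bA m).
have ki : k < content A i.
  by apply: leq_trans kj _; have := pA n i j (ltnW ij); rewrite -sA take_size.
have aij : arrival k i <= arrival k j.
  rewrite -ltnS arrival_lt ?arrival_ltn //.
  have := arrival_lt k j (arrival_ltn kj); rewrite ltnSn => /esym kj'.
  by apply: leq_trans kj' _; apply: pA; apply: ltnW.
have /andP[l1 u1] := entry_block ki; have /andP[l2 u2] := entry_block kj.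
move: aij; rewrite leq_eqVlt => /predU1P[aE|aij].
  have [iS _] := arrivalP ki; rewrite /entry -aE !addn1 ltnS ltn_add2l.
  exact: rank_ltn_mono.
apply: leq_ltn_trans u1 (leq_ltn_trans _ l2); rewrite leq_mul2l aij orbT //.
Qed.

Lemma entry_column k i : k.+1 < content A i -> entry k i < entry k.+1 i.
Proof.
move=> ki; have ki' := ltnW ki.
have /andP[l1 u1] := entry_block ki'; have /andP[l2 u2] := entry_block ki.
apply: leq_ltn_trans u1 (leq_ltn_trans _ l2); rewrite leq_mul2l.
by rewrite arrival_lt ?(ltnW (arrival_ltn ki)) // (arrivalP ki).2 ltnSn orbT.
Qed.

Hypothesis d_gt0 : 0 < d.
Let i0 := Ordinal d_gt0.

(** The default i0 is never reached, since row lengths are at most d. *)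
Definition tableau_row k :=
  [seq entry k (nth i0 (enum 'I_d) j) | j : nat <- iota 0 (row_len A k)].

(** The height of the first column is the number of nonempty rows. *)
Definition tableau_of := [seq tableau_row k | k <- iota 0 (content A i0)].

Lemma shapeA : partition_shape (content A).
Proof. by have /ballotP/(_ n) := bA; rewrite -sA take_size. Qed.

Lemma cell_ord k (j : nat) : j < row_len A k ->
  exists i : 'I_d, [/\ j = i, nth i0 (enum 'I_d) j = i & k < content A i].
Proof.
move=> jk; have jd := leq_trans jk (leq_row_len A k); exists (Ordinal jd); split=> //.
  exact: (nth_ord_enum i0 (Ordinal jd)).
by rewrite -ltn_row_len ?shapeA.
Qed.

Lemma nth_tableau_row k (j : nat) : j < row_len A k ->
  nth 0 (tableau_row k) j = entry k (nth i0 (enum 'I_d) j).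
Proof. by move=> jk; rewrite (nth_map 0) ?size_iota // nth_iota // add0n. Qed.

Lemma size_tableau_row k : size (tableau_row k) = row_len A k.
Proof. by rewrite size_map size_iota. Qed.

Lemma row_len_gt0 k : (0 < row_len A k) = (k < content A i0).
Proof. by rewrite -(ltn_row_len k i0 shapeA). Qed.

Lemma nth_tableau_of k : nth [::] tableau_of k = tableau_row k.
Proof.
have [kh|hk] := ltnP k (content A i0); first by rewrite (nth_map 0) ?size_iota // nth_iota.
rewrite nth_default ?size_map ?size_iota //; apply/esym/size0nil; rewrite size_tableau_row.
by apply/eqP; rewrite -leqn0 leqNgt row_len_gt0 -leqNgt.
Qed.

Lemma row_count_tableau_of m k : m <= n ->
  row_count tableau_of (r * m) k = row_len (take m A) k.
Proof.
move=> mn; rewrite /row_count nth_tableau_of count_map.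
have H (j : nat) : j \in iota 0 (row_len A k) ->
    preim (fun j : nat => entry k (nth i0 (enum 'I_d) j)) (fun x => x <= r * m) j =
    (j < row_len (take m A) k).
  rewrite mem_iota add0n => /cell_ord[i [-> iE ki]]; rewrite /= iE entry_leq //.
  by rewrite ltn_row_len //; apply/ballotP.
rewrite (eq_in_count H).
have le : row_len (take m A) k <= row_len A k.
  have := chain_mono (row_len_chain A) k; rewrite sA => /(_ _ _ mn (leqnn n)).
  by rewrite [take n A]take_oversize ?sA.
rewrite -(subnKC le) iotaD count_cat add0n.
rewrite (eq_in_count (a2 := predT)); last by move=> j; rewrite mem_iota.
rewrite count_predT size_iota (eq_in_count (a2 := pred0)) ?count_pred0 ?addn0 //.
by move=> j; rewrite mem_iota leqNgt => /andP[/negbTE].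
Qed.

Lemma mem_tableau_row x k :
  reflect (exists2 i : 'I_d, k < content A i & x = entry k i) (x \in tableau_row k).
Proof.
apply: (iffP mapP) => [[j]|[i ki ->]].
  by rewrite mem_iota => /cell_ord[i [_ -> ki]] ->; exists i.
by exists (i : nat); rewrite ?mem_iota ?nth_ord_enum // add0n ltn_row_len // shapeA.
Qed.

Lemma perm_tableau_of : perm_eq (flatten tableau_of) (iota 1 (r * n)).
Proof.
have U : uniq (flatten tableau_of).
  apply: allpairs_uniq_dep; [exact: iota_uniq|by move=> *; apply: iota_uniq|].
  move=> _ _ /allpairsPdep[k [j [_ + ->]]] /allpairsPdep[k' [j' [_ + ->]]] /=.
  rewrite !mem_iota !add0n => /cell_ord[i [-> -> ki]] /cell_ord[i' [-> -> ki']].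
  by move=> /(entry_inj ki ki')[-> ->].
have S : {subset flatten tableau_of <= iota 1 (r * n)}.
  move=> x /flattenP[s /mapP[k _ ->]] /mem_tableau_row[i ki ->].
  have /andP[lo hi] := entry_block ki; rewrite mem_iota add1n ltnS.
  rewrite (leq_trans _ lo) //=; apply: leq_trans hi _.
  by rewrite leq_mul2l (arrival_ltn ki) orbT.
have hn : content A i0 <= n by rewrite -sA count_size.
have Z : size (flatten tableau_of) = r * n.
  rewrite size_flatten /shape -map_comp sumnE big_map -sA -sum_card_rsets //.
  rewrite -(@sum_row_len _ _ n) ?sA //.
  rewrite -[RHS](big_mkord xpredT (row_len A)) -{1}[content A i0]subn0.
  rewrite -/(index_iota 0 (content A i0)).
  rewrite [RHS](big_cat_nat (leq0n _) hn) //= [X in _ = _ + X]big_nat_cond.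
  rewrite [X in _ = _ + X]big1 ?addn0.
    by apply: eq_bigr => k _; rewrite size_tableau_row.
  by move=> k /andP[/andP[hk _] _]; apply/eqP; rewrite -leqn0 leqNgt row_len_gt0 -leqNgt.
apply: uniq_perm => //; first exact: iota_uniq.
by have [] := uniq_min_size U S; rewrite ?size_iota ?Z.
Qed.

Lemma tableau_of_in_T : in_T (r * n) d tableau_of.
Proof.
have st : size tableau_of = content A i0 by rewrite size_map size_iota.
apply/and3P; split; last 1 first.
- by apply/allP => s /mapP[k _ ->]; rewrite size_tableau_row leq_row_len.
- apply/and5P; split.
  + apply/allP => s /mapP[k]; rewrite mem_iota add0n => kh ->.
    by rewrite -size_eq0 size_tableau_row -lt0n row_len_gt0.
  + apply/(sortedP 0) => k; rewrite size_map st => kh.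
    rewrite !(nth_map [::]) ?st ?(ltnW kh) // !nth_tableau_of !size_tableau_row.
    by apply/subset_leq_card/subsetP => i; rewrite !inE; apply: ltnW.
  + apply/allP => s /mapP[k _ ->]; apply/(sortedP 0) => j; rewrite size_tableau_row => jk.
    rewrite !nth_tableau_row // ?(ltnW jk) //.
    have [i [ji -> ki]] := cell_ord jk; have [i' [ji' -> ki']] := cell_ord (ltnW jk).
    by apply: entry_row; rewrite // -ji -ji'.
  + apply/(sortedP [::]) => k _; rewrite !nth_tableau_of; apply/allP => j.
    rewrite mem_iota add0n size_tableau_row => jk.
    have jk' : j < row_len A k.
      by apply: leq_trans jk _; apply/subset_leq_card/subsetP => i; rewrite !inE; apply: ltnW.
    rewrite !nth_tableau_row //; have [i [_ -> ki]] := cell_ord jk; exact: entry_column.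
  + by rewrite (perm_uniq perm_tableau_of) iota_uniq.
- exact: perm_tableau_of.
Qed.

Lemma tableau_of_row_condition : row_condition n r tableau_of.
Proof.
apply/forallP => m; apply/forallP => s; apply/implyP => s1.
have tT := tableau_of_in_T.
have pA m' := partition_shapeP _ (elimT (ballotP A) bA m').
have cellE x : 0 < x <= r * n ->
    exists k i, [/\ k < content A i, x = entry k i & row_of x tableau_of = k].
  move=> xn; have := mem_row tT x (row_of x tableau_of); rewrite xn eqxx nth_tableau_of.
  by move=> /mem_tableau_row[i ki xE]; exists (row_of x tableau_of), i.
have mn := ltn_ord m; have sr := ltn_ord s.
have rmn : r * m.+1 <= r * n by rewrite leq_mul2l mn orbT.
have rm : r * m.+1 = r * m + r by rewrite mulnSr.
have [k [i [ki xE ->]]] := cellE (r * m + s) ltac:(lia).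
have [k' [i' [ki' yE ->]]] := cellE (r * m + s + 1) ltac:(lia).
have /andP[l1 u1] := entry_block ki; have /andP[l2 u2] := entry_block ki'.
rewrite -xE in l1 u1; rewrite -yE in l2 u2.
have am : arrival k i = m by apply: (block_unique l1 u1); lia.
have am' : arrival k' i' = m by apply: (block_unique l2 u2); lia.
have [iS kE] := arrivalP ki; have [iS' kE'] := arrivalP ki'.
rewrite -kE -kE' am am'; apply: pA; rewrite leqNgt; apply/negP => ii'.
rewrite am' in iS'; have := rank_ltn_mono iS' ii'.
by move: xE yE; rewrite /entry am am'; lia.
Qed.

End Build.

Lemma rows_of_inj k : injective (@rows_of k).
Proof.
move=> p q; rewrite /rows_of => pq; apply/val_inj.
apply: (inj_map (f := fun row : k.-bseq 'I_k.+1 => [seq val x | x <- val row])) pq.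
by move=> a b /(inj_map val_inj)/val_inj.
Qed.

(** The bounds in the type [filling] hold for every tableau with entries 1, ..., k:
    no row is empty, so there are at most k rows, of length at most k. *)
Lemma rows_of_surj k d t : in_T k d t -> exists p : filling k, rows_of p = t.
Proof.
move=> /and3P[/and5P[/allP ne _ _ _ _] pt _].
have sz : sumn (shape t) = k by rewrite -size_flatten (perm_size pt) size_iota.
have st : size t <= k.
  rewrite -sz /shape; elim: (t) ne => //= s u IH ne; rewrite -add1n leq_add //.
    by rewrite lt0n size_eq0 ne ?mem_head.
  by apply: IH => s' s'u; apply: ne; rewrite inE s'u orbT.
have sr s : s \in t -> size s <= k.
  rewrite -sz /shape; elim: (t) => //= s' u IH; rewrite inE => /predU1P[->|/IH H].
    exact: leq_addr.
  by apply: leq_trans H _; apply: leq_addl.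
have xr s x : s \in t -> x \in s -> x <= k.
  move=> sT xs; have : x \in flatten t by apply/flattenP; exists s.
  by rewrite (perm_mem pt) mem_iota; lia.
pose f (s : seq nat) : k.-bseq 'I_k.+1 := insub_bseq k [seq inord x | x <- s].
have fE s : s \in t -> [seq val x | x <- val (f s)] = s.
  move=> sT; rewrite /f /insub_bseq val_insubd size_map sr //= -map_comp.
  rewrite -[RHS]map_id; apply/eq_in_map => x xs /=; rewrite inordK // ltnS; exact: xr xs.
exists (insub_bseq k (map f t)); rewrite /rows_of /insub_bseq val_insubd size_map st /=.
by rewrite -map_comp -[RHS]map_id; apply/eq_in_map => s sT /=; apply: fE.
Qed.

(** Row lengths are the only link between the two sides: a tableau is related to
    the sequence whose i-th diagram has as row lengths the numbers of entries at
    most [r * i] in the rows of the tableau. *)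
Lemma card_tableau_pairs n d r : 0 < d -> #|tableau_pairs n d r| = #|ballot_pairs n d r|.
Proof.
move=> d0.
pose C (t : seq (seq nat)) (A : seq {set 'I_d}) :=
  forall i, i <= n -> row_len (take i A) =1 row_count t (r * i).
pose R (p : filling (r * n) * filling (r * n)) (q : n.-tuple {set 'I_d} * n.-tuple {set 'I_d}) :=
  C (rows_of p.1) q.1 /\ C (rows_of p.2) q.2.
have Crow t A : in_T (r * n) d t -> size A = n -> C t A ->
    forall k, row_len A k = size (nth [::] t k).
  by move=> tT sA tA k; rewrite -(row_count_all tT) -(tA n) // -sA take_size.
have part A : ballot A -> size A = n -> partition_shape (@content d A).
  by move=> /ballotP bA sA; rewrite -[A]take_size; apply: bA.
apply: (@card_rel _ _ R).
- move=> [p q]; rewrite inE /= => /and5P[pT qT /eqP sh pr qr].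
  have [A [sA rA bA pA]] := tableau_columns pT pr.
  have [B [sB rB bB qB]] := tableau_columns qT qr.
  exists (tcast sA (in_tuple A), tcast sB (in_tuple B)); last by rewrite /R /= !val_tcast.
  rewrite inE /= !val_tcast rA rB bA bB /=; apply/forallP => j; apply/eqP.
  apply: row_len_content; [exact: part|exact: part|] => k.
  rewrite (Crow _ _ pT sA pA) (Crow _ _ qT sB qB).
  by have /(congr1 (fun s => nth 0 s k)) := sh; rewrite !nth_shape.
- move=> [A B]; rewrite inE /= => /and5P[rA rB bA bB /forallP AB].
  have sA := size_tuple A; have sB := size_tuple B.
  have TA := tableau_of_in_T sA rA bA d0; have TB := tableau_of_in_T sB rB bB d0.
  have [p pE] := rows_of_surj TA; have [q qE] := rows_of_surj TB.
  have CA : C (tableau_of n r A d0) A.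
    by move=> i lin k; rewrite row_count_tableau_of.
  have CB : C (tableau_of n r B d0) B.
    by move=> i lin k; rewrite row_count_tableau_of.
  exists (p, q); last by rewrite /R /= pE qE.
  rewrite inE /= pE qE TA TB !tableau_of_row_condition // !andbT /=; apply/eqP.
  apply: (shape_eq TA TB) => k; rewrite -(Crow _ _ TA sA CA) -(Crow _ _ TB sB CB).
  by apply: content_row_len => j; apply/eqP.
- move=> [p q] [p' q'] [A B]; rewrite !inE /=.
  move=> /and5P[pT qT _ pr qr] /and5P[pT' qT' _ pr' qr'] [/= pA qB] [/= pA' qB'].
  congr (_, _); apply: rows_of_inj.
    by apply: (tableau_unique pT pT' pr pr') => i lin k; rewrite -pA // -pA'.
  by apply: (tableau_unique qT qT' qr qr') => i lin k; rewrite -qB // -qB'.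
- move=> [p q] [A B] [A' B']; rewrite !inE /=.
  move=> /and5P[_ _ bA bB _] /and5P[_ _ bA' bB' _] [/= pA qB] [/= pA' qB'].
  congr (_, _); apply/val_inj => /=; apply: (@row_len_inj _ n); rewrite ?size_tuple // => i lin k.
    by rewrite pA // pA'.
  by rewrite qB // qB'.
Qed.

(** * The reflection argument *)

Section Reflection.
Variables (d r : nat).
Local Open Scope ring_scope.
Implicit Types (A B : seq {set 'I_d}) (S : {set 'I_d}) (z : 'rV[int]_d).

Definition indicator S : 'rV[int]_d := \row_j (j \in S)%:Z.

Definition content_vec A : 'rV[int]_d := \row_j (content A j)%:Z.

(** The staircase.  A walk at the point p is tracked by z = delta - p, so that p is
    weakly decreasing exactly if z is strictly increasing, and the endpoint
    T(pi) becomes the permuted staircase. *)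
Definition delta : 'rV[int]_d := \row_j j%:Z.

Definition chamber z := [forall i : 'I_d, forall j : 'I_d, (i < j)%N ==> (z 0 i < z 0 j)].

Definition alternating (f : 'rV[int]_d -> int) :=
  forall (s : 'S_d) z, f (col_perm s z) = (-1) ^+ s * f z.

(** The signed indicator of the permuted staircases, which turns the sum over
    permutations into one function of the endpoint. *)
Definition alt_delta z : int := \sum_(pi : 'S_d) (-1) ^+ pi * (z == col_perm pi delta)%:Z.

Lemma chamberP z : reflect (forall i j : 'I_d, (i < j)%N -> z 0 i < z 0 j) (chamber z).
Proof.
apply: (iffP forallP) => [H i j ij|H i]; first by move/forallP: (H i) => /(_ j)/implyP; apply.
by apply/forallP => j; apply/implyP; apply: H.
Qed.

Lemma content_vec_cons S A : content_vec (S :: A) = indicator S + content_vec A.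
Proof. by apply/rowP => j; rewrite !mxE /content /= PoszD. Qed.

Lemma content_vec_nil : content_vec [::] = 0.
Proof. by apply/rowP => j; rewrite !mxE. Qed.

Lemma alternating_alt_delta : alternating alt_delta.
Proof.
move=> s z; rewrite /alt_delta (reindex_inj (mulgI s)) big_distrr /=; apply: eq_bigr => pi _.
rewrite odd_permM signr_addb -mulrA; congr (_ * (_ * _)); congr (nat_of_bool _)%:Z.
by rewrite col_permM; apply/eqP/eqP => [/(congr1 (col_perm s^-1%g))|-> //];
  rewrite -!col_permM mulKg mulVg col_perm1.
Qed.

Lemma alternating_wall f z (i j : 'I_d) : alternating f -> i != j -> z 0 i = z 0 j -> f z = 0.
Proof.
move=> alt ij zij; have := alt (tperm i j) z; rewrite odd_tperm ij.
have -> : col_perm (tperm i j) z = z.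
  by apply/rowP => k; rewrite mxE; case: tpermP => [->|->|].
by rewrite expr1; lia.
Qed.

(** Permuting the coordinates of the starting point amounts to permuting the
    columns in all the sets of [A], which preserves their sizes. *)
Lemma alternating_sum n f (e : int) : alternating f ->
  alternating (fun z => \sum_(A : n.-tuple {set 'I_d} | rsets r A) f (z + e *: content_vec A)).
Proof.
move=> alt s z; rewrite big_distrr /=.
pose h (A : n.-tuple {set 'I_d}) := [tuple of map (fun S : {set 'I_d} => s @: S) A].
have hinj : injective h.
  move=> A B /(congr1 val) /= /(inj_map (imset_inj (@perm_inj _ s))) AB; exact: val_inj.
rewrite [RHS](reindex_inj hinj) /=; apply: eq_big => [A|A _].
  by rewrite /rsets all_map; apply: eq_all => S /=; rewrite card_imset //; apply: perm_inj.
rewrite -alt; congr (f _); apply/rowP => j; rewrite !mxE; congr (_ + _ * _%:Z).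
rewrite /content count_map; apply: eq_count => S /=.
by rewrite mem_imset //; apply: perm_inj.
Qed.

Lemma sum_tupleS n (T : finType) (P : pred (seq T)) (F : seq T -> int) :
  \sum_(A : n.+1.-tuple T | P A) F A =
  \sum_(S : T) \sum_(A : n.-tuple T | P (S :: A)) F (S :: A).
Proof.
rewrite pair_big_dep /= (reindex (fun p : T * n.-tuple T => [tuple of p.1 :: p.2])) /=.
  by apply: eq_bigl => -[].
exists (fun t : n.+1.-tuple T => (thead t, [tuple of behead t])) => [[x t] _|t _].
  by congr (_, _); apply: val_inj.
by rewrite -tuple_eta.
Qed.

Definition in_chamber (e : int) z A :=
  all (fun i => chamber (z + e *: content_vec (take i A))) (iota 0 (size A).+1).

Lemma in_chamber_cons e z S A :
  in_chamber e z (S :: A) = chamber z && in_chamber e (z + e *: indicator S) A.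
Proof.
rewrite /in_chamber -[iota 0 _]/(0 :: iota (1 + 0) (size A).+1)%N iotaDl /=.
rewrite content_vec_nil scaler0 addr0; congr (_ && _); rewrite all_map.
rewrite content_vec_cons scalerDr addrA add0n; congr (_ && _).
apply: eq_all => i /=; rewrite content_vec_cons scalerDr addrA //.
Qed.

(** Two coordinates that differ by at least 1 change their difference by at most 1,
    so a step out of the chamber makes two coordinates equal. *)
Lemma chamber_step (e : int) f z S : e = 1 \/ e = -1 -> alternating f -> chamber z ->
  ~~ chamber (z + e *: indicator S) -> f (z + e *: indicator S) = 0.
Proof.
move=> e1 alt /chamberP cz; rewrite negb_forall => /existsP[i]; rewrite negb_forall => /existsP[j].
rewrite negb_imply => /andP[ij nlt]; apply: (alternating_wall (i := i) (j := j)) => //.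
  by apply: contraTneq ij => ->; rewrite ltnn.
have := cz i j ij; move: nlt; rewrite !mxE.
move: (z 0 i) (z 0 j) => a b.
by case: (i \in S); case: (j \in S); case: e1 => ->; rewrite ?mul1r ?mulN1r /=; lia.
Qed.

(** Paths that leave the chamber cancel: the sum over all continuations of a path
    is again alternating in the point where the continuation starts, so it
    vanishes when this point lies on a wall. *)
Lemma sum_in_chamber n (e : int) f z : e = 1 \/ e = -1 -> alternating f -> chamber z ->
  \sum_(A : n.-tuple {set 'I_d} | rsets r A) f (z + e *: content_vec A) =
  \sum_(A : n.-tuple {set 'I_d} | rsets r A && in_chamber e z A) f (z + e *: content_vec A).
Proof.
move=> e1 alt; elim: n z => [|n IH] z cz.
  apply: eq_bigl => A; rewrite tuple0 /= /in_chamber /= andbT content_vec_nil scaler0 addr0.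
  by rewrite cz.
rewrite (sum_tupleS n (fun A => rsets r A) (fun A => f (z + e *: content_vec A))).
rewrite (sum_tupleS n (fun A => rsets r A && in_chamber e z A)
  (fun A => f (z + e *: content_vec A))).
apply: eq_bigr => S _; have [Sr|Sr] := boolP (#|S| == r); last first.
  by rewrite /= !big1 // => A; rewrite (negbTE Sr).
under eq_bigr => A _ do rewrite content_vec_cons scalerDr addrA.
under [RHS]eq_bigr => A _ do rewrite content_vec_cons scalerDr addrA.
under eq_bigl => A do rewrite /= Sr.
under [RHS]eq_bigl => A do rewrite in_chamber_cons cz /= Sr /=.
have [cz'|ncz] := boolP (chamber (z + e *: indicator S)); first exact: IH.
rewrite [LHS](chamber_step e1 (alternating_sum n e alt) cz ncz) big1 // => A /andP[_].
by rewrite /in_chamber /= take0 content_vec_nil scaler0 addr0 (negbTE ncz).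
Qed.

Lemma increasing_perm_ge (s : 'S_d) : (forall i j : 'I_d, i < j -> s i < s j)%N ->
  forall j : 'I_d, (j <= s j)%N.
Proof.
move=> inc j; move: {2}(j : nat) (erefl (j : nat)) => m; elim: m j => [|m IH] j jm.
  by rewrite jm.
have md : (m < d)%N by have := ltn_ord j; lia.
have := IH (Ordinal md) erefl; have := inc (Ordinal md) j; rewrite /= jm; lia.
Qed.

Lemma chamber_perm_delta (s : 'S_d) : chamber (col_perm s delta) -> s = 1%g.
Proof.
move=> /chamberP H.
have inc (i j : 'I_d) : (i < j)%N -> (s i < s j)%N by move=> /H; rewrite !mxE.
(* The inverse is increasing as well, so j <= s j and j <= s^-1 j. *)
apply/permP => j; rewrite perm1; apply/val_inj/eqP; rewrite eqn_leq increasing_perm_ge // andbT.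
have := @increasing_perm_ge s^-1%g _ (s j); rewrite permK; apply=> i i' ii'.
rewrite ltnNge; apply/negP; rewrite leq_eqVlt => /predU1P[/val_inj/perm_inj E|/inc].
  by rewrite E ltnn in ii'.
by rewrite !permKV ltnNge ltnW.
Qed.

(** The staircase is the only permuted staircase with increasing coordinates. *)
Lemma alt_delta_chamber z : chamber z -> alt_delta z = (z == delta)%:Z.
Proof.
move=> cz; rewrite /alt_delta (bigD1 1%g) //= big1 ?addr0.
  by rewrite odd_perm1 mul1r col_perm1.
move=> s s1; have [E|] := eqVneq z; last by rewrite mulr0.
by rewrite E in cz; rewrite (chamber_perm_delta cz) eqxx in s1.
Qed.

Lemma chamber_partition (c : 'I_d -> nat) :
  chamber (delta - \row_j (c j)%:Z) = partition_shape c.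
Proof.
apply/chamberP/partition_shapeP => H i j ij; last first.
  by rewrite !mxE; have := H i j (ltnW ij); lia.
move: {2}(j - i)%N (erefl (j - i)%N) => k; elim: k j ij => [|k IH] j ij jk.
  by rewrite [j](_ : _ = i) //; apply/val_inj => /=; lia.
have j'd : (j.-1 < d)%N by have := ltn_ord j; lia.
apply: leq_trans (IH (Ordinal j'd) _ _) => /=; try lia.
by have := H (Ordinal j'd) j; rewrite !mxE /=; lia.
Qed.

End Reflection.

(** * Walks as pairs of sequences of sets *)

Section Words.
Variables (d r : nat).
Implicit Types (A B : seq {set 'I_d}) (u : seq 'I_d).

Definition word A : seq 'I_d := flatten [seq enum X | X : {set 'I_d} <- A].

Lemma word_shape A : rsets r A -> shape [seq enum X | X : {set 'I_d} <- A] = nseq (size A) r.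
Proof.
by elim: A => //= S A IH /andP[/eqP Sr /IH <-]; rewrite -cardE Sr.
Qed.

Lemma size_word A : rsets r A -> size (word A) = r * size A.
Proof. by move=> rA; rewrite size_flatten word_shape // sumn_nseq. Qed.

Lemma count_word A j : count_mem j (word A) = content A j.
Proof.
rewrite /word /content; elim: A => //= S A IH; rewrite count_cat IH; congr (_ + _).
by rewrite count_uniq_mem ?enum_uniq // mem_enum.
Qed.

Lemma sorted_enum (S : {set 'I_d}) : sorted (relpre val ltn) (enum S).
Proof.
rewrite -sorted_map; apply: (subseq_sorted ltn_trans (s2 := iota 0 d));
  last exact: iota_ltn_sorted.
by rewrite -val_enum_ord map_subseq // {1}enumT; apply: filter_subseq.
Qed.

Lemma enum_sorted u : sorted (relpre val ltn) u -> enum [set j in u] = u.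
Proof.
move=> su; apply: (irr_sorted_eq (leT := relpre val ltn)) => //.
- by move=> x y z /=; apply: ltn_trans.
- by move=> x /=; rewrite ltnn.
- exact: sorted_enum.
- by move=> x; rewrite mem_enum inE.
Qed.

Lemma reshape_word A : rsets r A ->
  reshape (nseq (size A) r) (word A) = [seq enum X | X : {set 'I_d} <- A].
Proof. by move=> rA; rewrite -word_shape // flattenK. Qed.

Lemma word_inj A B : rsets r A -> rsets r B -> size A = size B -> word A = word B -> A = B.
Proof.
move=> rA rB sAB AB.
have injf : injective (fun S : {set 'I_d} => enum S).
  by move=> S S' SS'; apply/setP => j; rewrite -mem_enum SS' mem_enum.
have := reshape_word rB; rewrite -sAB -AB reshape_word //; exact: inj_map injf _ _.
Qed.

Definition block u i := take r (drop (r * i) u).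

Lemma block_increasingP n u : size u = r * n ->
  reflect (forall i, i < n -> sorted (relpre val ltn) (block u i))
          (block_increasing n r (map val u)).
Proof.
move=> su; have sb i : i < n -> r * i + r <= r * n by move=> lin; rewrite -mulnSr leq_mul2l lin orbT.
have bs i : i < n -> size (block u i) = r.
  by move=> /sb rin; rewrite size_take size_drop su; case: ifP; lia.
have nb i s : i < n -> s < r -> nth 0 (map val (block u i)) s = nth 0 (map val u) (r * i + s).
  by move=> lin sr; rewrite map_take map_drop nth_take // nth_drop.
apply: (iffP forallP) => [H i lin|H i].
  rewrite -sorted_map; apply/(sortedP 0) => s; rewrite size_map bs // => sr.
  rewrite !nb //; last exact: ltnW.
  by move/forallP: (H (Ordinal lin)) => /(_ (Ordinal sr)) /=; rewrite addnS.
apply/forallP => s; apply/implyP => s1; have := H i (ltn_ord i).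
rewrite -sorted_map => /(sortedP 0)/(_ s.-1); rewrite size_map bs // prednK // => /(_ (ltn_ord s)).
by rewrite !nb //; [rewrite -(prednK s1) addnS|have := ltn_ord s; lia].
Qed.

Lemma block_word A i : rsets r A -> i < size A -> block (word A) i = enum (nth set0 A i).
Proof.
move=> rA iA; rewrite -(nth_map _ [::] (fun S : {set 'I_d} => enum S)) //.
rewrite -[map _ _]reshape_word // nth_reshape nth_nseq iA.
by rewrite take_nseq ?sumn_nseq // ltnW.
Qed.

Lemma block_increasing_word n A :
  size A = n -> rsets r A -> block_increasing n r (map val (word A)).
Proof.
move=> <- rA; apply/block_increasingP; first exact: size_word.
by move=> i iA; rewrite block_word //; apply: sorted_enum.
Qed.

(** An increasing block is the enumeration of the set of its letters. *)
Lemma block_increasing_words n u : size u = r * n -> block_increasing n r (map val u) ->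
  exists A, [/\ size A = n, rsets r A & u = word A].
Proof.
move=> su /(block_increasingP su) bu.
have sh : shape (reshape (nseq n r) u) = nseq n r by apply: reshapeKl; rewrite sumn_nseq su.
exists [seq [set j in b] | b : seq 'I_d <- reshape (nseq n r) u].
have sR : size (reshape (nseq n r) u) = n by rewrite size_reshape size_nseq.
have E : [seq enum X | X : {set 'I_d} <-
      [seq [set j in b] | b : seq 'I_d <- reshape (nseq n r) u]] = reshape (nseq n r) u.
  rewrite -map_comp -[RHS]map_id; apply/eq_in_map => b /(nthP [::])[i]; rewrite sR => lin <- /=.
  apply: enum_sorted; have := bu i lin; rewrite nth_reshape nth_nseq lin take_nseq ?sumn_nseq //.
  exact: ltnW.
split; first by rewrite size_map.
  apply/allP => X XA; have : #|X| \in nseq n r by rewrite -sh -E cardE; apply/map_f/map_f.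
  by rewrite mem_nseq => /andP[].
by rewrite /word E reshapeKr // sumn_nseq su.
Qed.

(** After the first negative step there are only negative steps. *)
Lemma positives_first (w : seq (step d)) :
    (forall i j, i < size w -> j < size w -> forall x,
       (nth x w i).1 -> ~~ (nth x w j).1 -> i < j) ->
  w = [seq x <- w | x.1] ++ [seq x <- w | ~~ x.1].
Proof.
elim: w => //= -[[] j0] w IH H /=.
  by rewrite -IH // => i j iw jw x xi xj; apply: (H i.+1 j.+1 _ _ x).
have neg : all (fun x => ~~ x.1) w.
  apply/allP => x xw; apply/negP => x1; have := H (index x w).+1 0 _ _ x.
  by rewrite /= !ltnS index_mem nth_index // => /(_ xw isT x1 isT).
have -> : [seq x <- w | x.1] = [::].
  by apply/eqP; rewrite -[_ == _]negbK -has_filter -all_predC.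
by rewrite /=; congr (_ :: _); apply/esym/all_filterP.
Qed.

Definition walk_of A B : seq (step d) :=
  [seq (true, j) | j <- word A] ++ [seq (false, j) | j <- word B].

Lemma filter_walk_of A B :
  [seq x <- walk_of A B | x.1] = [seq (true, j) | j <- word A] /\
  [seq x <- walk_of A B | ~~ x.1] = [seq (false, j) | j <- word B].
Proof.
rewrite /walk_of !filter_cat !filter_map /preim /=.
by rewrite !filter_predT !filter_pred0 /= cats0.
Qed.

Lemma pos_dirs_walk_of A B : pos_dirs (walk_of A B) = map val (word A).
Proof. by rewrite /pos_dirs (filter_walk_of A B).1 -map_comp. Qed.

Lemma neg_dirs_walk_of A B : neg_dirs (walk_of A B) = map val (word B).
Proof. by rewrite /neg_dirs (filter_walk_of A B).2 -map_comp. Qed.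

Lemma sum_delta u :
  (\sum_(j <- u) delta_mx 0 j = \row_j (count_mem j u)%:Z :> 'rV[int]_d)%R.
Proof.
elim: u => [|j u IH]; first by rewrite big_nil; apply/rowP => i; rewrite !mxE.
rewrite big_cons IH; apply/rowP => i; rewrite !mxE /= eq_sym.
by case: (j == i); rewrite ?PoszD.
Qed.

Lemma endpoint_walk_of A B : (endpoint (walk_of A B) = content_vec A - content_vec B)%R.
Proof.
rewrite /endpoint /walk_of big_cat !big_map /=; congr (_ + _)%R; last rewrite sumrN; rewrite sum_delta.
  by apply/rowP => j; rewrite !mxE count_word.
by congr (- _)%R; apply/rowP => j; rewrite !mxE count_word.
Qed.

Lemma card_What' n (p : 'rV[int]_d) :
  #|What' n r p| = #|[set q : n.-tuple {set 'I_d} * n.-tuple {set 'I_d} |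
     [&& rsets r q.1, rsets r q.2 & (content_vec q.1 - content_vec q.2 == p)%R]]|.
Proof.
pose R (w : (2 * (r * n)).-tuple (step d)) (q : n.-tuple {set 'I_d} * n.-tuple {set 'I_d}) :=
  val w = walk_of q.1 q.2.
apply: (@card_rel _ _ R).
- move=> w; rewrite !inE => /andP[/andP[/eqP wp /forallP Hw] /and4P[/eqP sp /eqP sn bp bn]].
  have wE : val w = [seq x <- w | x.1] ++ [seq x <- w | ~~ x.1].
    apply: positives_first => i j; rewrite size_tuple => iw jw x xi xj.
    have /forallP/(_ (Ordinal jw))/implyP := Hw (Ordinal iw).
    by rewrite !(tnth_nth x) /= xi xj; apply.
  pose u := [seq x.2 | x <- w & x.1]; pose v := [seq x.2 | x <- w & ~~ x.1].
  have uE : pos_dirs w = map val u by rewrite /u -map_comp.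
  have vE : neg_dirs w = map val v by rewrite /v -map_comp.
  move: sp sn bp bn; rewrite uE vE ![size (map val _)]size_map => su sv bu bv.
  have [A [sA rA uA]] := block_increasing_words su bu.
  have [B [sB rB vB]] := block_increasing_words sv bv.
  have Rw : val w = walk_of A B.
    rewrite wE /walk_of -uA -vB; congr (_ ++ _).
      rewrite /u -map_comp -[LHS]map_id; apply/eq_in_map => -[b j].
      by rewrite mem_filter /= => /andP[-> _].
    rewrite /v -map_comp -[LHS]map_id; apply/eq_in_map => -[b j].
    by rewrite mem_filter /= => /andP[/negbTE-> _].
  exists (tcast sA (in_tuple A), tcast sB (in_tuple B)); last by rewrite /R /= !val_tcast.
  by rewrite inE /= !val_tcast rA rB -wp -endpoint_walk_of /= -Rw eqxx.
- move=> [A B]; rewrite inE /= => /and3P[rA rB /eqP AB].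
  have sw : size (walk_of A B) == 2 * (r * n).
    by rewrite size_cat !size_map !size_word // !size_tuple mul2n addnn.
  exists (Tuple sw); rewrite /R ?inE //= pos_dirs_walk_of neg_dirs_walk_of !size_map.
  rewrite !size_word // !size_tuple !eqxx !block_increasing_word ?size_tuple // endpoint_walk_of AB.
  rewrite eqxx !andbT /=; apply/forallP => i; apply/forallP => j; apply/implyP.
  have x0 : step d := tnth (Tuple sw) i.
  rewrite !(tnth_nth x0) /= !nth_cat !size_map.
  have [iA|Ai] := ltnP i (size (word A)); have [jA|Aj] := ltnP j (size (word A)).
  + have := mem_nth x0 (s := [seq (true, j) | j <- word A]).
    by move=> /(_ j); rewrite size_map jA => /(_ isT)/mapP[y _ ->]; rewrite andbF.
  + by move=> _; apply: leq_trans Aj.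
  + have := mem_nth x0 (s := [seq (true, j) | j <- word A]).
    by move=> /(_ j); rewrite size_map jA => /(_ isT)/mapP[y _ ->]; rewrite andbF.
  + have := mem_nth x0 (s := [seq (false, j) | j <- word B]).
    move=> /(_ (i - size (word A))); rewrite size_map => H /andP[+ _].
    have : i - size (word A) < size (word B).
      by move: (eqP sw) (ltn_ord i); rewrite size_cat !size_map; lia.
    by move=> /H/mapP[y _ ->].
- by move=> w w' q _ _ Rw Rw'; apply/val_inj; rewrite Rw Rw'.
- move=> w [A B] [A' B']; rewrite !inE /= => /and3P[rA rB _] /and3P[rA' rB' _] Rw Rw'.
  have E : walk_of A B = walk_of A' B' by rewrite -Rw -Rw'.
  congr (_, _); apply/val_inj => /=; apply: word_inj; rewrite ?size_tuple //.
    by apply: (inj_map val_inj); rewrite -(pos_dirs_walk_of A B) E pos_dirs_walk_of.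
  by apply: (inj_map val_inj); rewrite -(neg_dirs_walk_of A B) E neg_dirs_walk_of.
Qed.

End Words.

Section SignedSum.
Variables (n d r : nat).
Local Open Scope ring_scope.
Local Notation tup := (n.-tuple {set 'I_d}).

Lemma in_chamberN_delta (A : tup) : in_chamber (-1) (delta d) A = ballot A.
Proof.
have E i : chamber (delta d + -1 *: content_vec (take i A)) = partition_shape (content (take i A)).
  by rewrite scaleN1r chamber_partition.
apply/allP/ballotP => H i; last by rewrite E.
have [iA|Ai] := leqP i (size A); first by rewrite -E H // mem_iota.
have := H (size A); rewrite E take_size (take_oversize (ltnW Ai)); apply.
by rewrite mem_iota /=.
Qed.

(** When [A] and [B] have the same content, the point reached after a prefix of
    [B] is [delta] minus the content of the remaining suffix. *)
Lemma in_chamber_rev (A B : tup) : content_vec A = content_vec B ->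
  in_chamber 1 (delta d - content_vec A) B = ballot (rev B).
Proof.
move=> AB; have E i : chamber (delta d - content_vec A + 1 *: content_vec (take i B)) =
    partition_shape (content (drop i B)).
  rewrite -(chamber_partition) scale1r AB; congr (chamber _); apply/rowP => j; rewrite !mxE.
  by rewrite -[X in content X j](cat_take_drop i B) /content count_cat PoszD; lia.
have P (C : seq {set 'I_d}) : partition_shape (content (rev C)) = partition_shape (content C).
  by apply/partition_shapeP/partition_shapeP => H i j ij;
    have := H i j ij; rewrite /content !count_rev.
apply/allP/ballotP => H i.
  by rewrite take_rev P -E H // mem_iota; lia.
rewrite mem_iota add0n ltnS => iB; rewrite E.
by rewrite -(subKn iB) -P -take_rev H.
Qed.

(** The cancellation is applied first to the part of the walk given by [A], with
    the sum over all [B] as alternating function, and then, from each endpoint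
    that remains, to the part given by [B]. *)
Lemma sum_What'_ballot_pairs :
  \sum_(pi : 'S_d) (-1) ^+ pi * #|What' n r (T_point pi)|%:Z = #|ballot_pairs n d r|%:Z.
Proof.
have T_pointE (pi : 'S_d) : T_point pi = delta d - col_perm pi (delta d).
  by apply/rowP => j; rewrite !mxE.
transitivity (\sum_(A : tup | rsets r A) \sum_(B : tup | rsets r B)
    alt_delta (delta d - content_vec A + 1 *: content_vec B)).
  rewrite pair_big /= exchange_big /=; apply: eq_bigr => pi _.
  rewrite card_What' T_pointE -big_distrr /= -sum1_card -(big_morph Posz PoszD erefl).
  congr (_ * _%:Z).
  rewrite big_mkcond [RHS]big_mkcond; apply: eq_bigr => -[A B] _; rewrite inE /=.
  case: (rsets r A) => //; case: (rsets r B) => //=; rewrite scale1r.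
  suff -> : (delta d - content_vec A + content_vec B == col_perm pi (delta d)) =
      (content_vec A - content_vec B == delta d - col_perm pi (delta d)) by case: ifP.
  apply/eqP/eqP => [<-|H]; first by rewrite opprD opprB !addrA [delta d + _]addrC addrK.
  by rewrite -[RHS](subKr (delta d)) -H opprB addrA addrAC.
have alt := alternating_sum r n 1 (@alternating_alt_delta d).
have cd : chamber (delta d) by apply/chamberP => i j; rewrite !mxE ltz_nat.
have := sum_in_chamber r n (or_intror erefl) alt cd.
under eq_bigr => A _ do rewrite scaleN1r.
under [RHS]eq_bigr => A _ do rewrite scaleN1r.
move=> ->.
transitivity (\sum_(A : tup | rsets r A && ballot A)
   \sum_(B : tup | rsets r B) ((content_vec A == content_vec B) && ballot (rev B))%:Z).
  apply: eq_big => [A|A /andP[_ inA]]; first by rewrite in_chamberN_delta.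
  have cA : chamber (delta d - content_vec A).
    move/allP: inA => /(_ (size A)); rewrite mem_iota leqnn => /(_ isT).
    by rewrite take_size scaleN1r.
  rewrite (sum_in_chamber r n (or_introl erefl) (@alternating_alt_delta d) cA).
  rewrite big_mkcond [RHS]big_mkcond /=; apply: eq_bigr => B _.
  case: (rsets r B) => //=; have [inB|ninB] := ifP.
    rewrite alt_delta_chamber; last first.
      by move/allP: inB => /(_ (size B)); rewrite mem_iota leqnn take_size; apply.
    rewrite scale1r -addrA eq_sym -subr_eq0 opprD addrA subrr sub0r oppr_eq0 addrC subr_eq0 eq_sym.
    by have [AB|//] := eqVneq; rewrite -(in_chamber_rev AB) inB.
  by have [AB|//] := eqVneq; rewrite -(in_chamber_rev AB) ninB.
rewrite pair_big_dep /= -sum1_card (big_morph Posz PoszD erefl) big_mkcond [RHS]big_mkcond /=.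
pose h (q : tup * tup) := (q.1, [tuple of rev q.2]).
have hK : involutive h by move=> [A B]; congr (_, _); apply: val_inj; rewrite /= revK.
rewrite [RHS](reindex_inj (inv_inj hK)) /=; apply: eq_bigr => -[A B] _; rewrite inE /=.
have -> : rsets r (rev B) = rsets r B by apply: all_rev.
case: (rsets r A) => //=; case: (rsets r B) => //=; last by rewrite andbF.
case: (ballot A) => //=; rewrite andbC; case: (ballot (rev B)) => //=.
have -> : [forall j, content A j == content (rev B) j] = (content_vec A == content_vec B).
  apply/forallP/eqP => [H|/rowP H j].
    by apply/rowP => j; rewrite !mxE (eqP (H j)) /content count_rev.
  by have := H j; rewrite !mxE /content count_rev => -[->].
by case: eqP.
Qed.

End SignedSum.

Theorem theorem4 (n d r : nat) (hn : 0 < n) (hd : 0 < d) (hr : 0 < r) :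
  ghat n d r = #|tableau_pairs n d r| /\
  ((ghat n d r)%:Z =
     \sum_(pi : 'S_d) (-1) ^+ pi * #|What' n r (T_point pi)|%:Z)%R.
Proof.
by rewrite sum_What'_ballot_pairs card_tableau_pairs // ghat_ballot_pairs.
Qed.
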